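(* Let $\theta$ be a primitive aperiodic length-$\ell$ substitution and let $\tilde\theta$ be its pure base. Then $(X_\theta,\sigma)$ has an aperiodic almost automorphic shift factor if and only if the inner encoding associated to the collared substitution $\tilde\theta^{(-1,1)}$ is aperiodic.
   Context: Substitutions. A length-$\ell$ substitution $\theta$ ($\ell\ge 2$) on a finite alphabet $\mathcal A$ is an ordered collection of column maps $\theta_0,\dots,\theta_{\ell-1}:\mathcal A\to\mathcal A$; it is identified with $a\mapsto\theta(a)=\theta_0(a)\cdots\theta_{\ell-1}(a)$ and extended to words and bi-infinite sequences by concatenation ($\theta(u)_{i\ell+m}=\theta_m(u_i)$). $\theta^n$ is a length-$\ell^n$ substitution. A word is allowed if it occurs in some $\theta^k(a)$; $X_\theta\subset\mathcal A^{\mathbb Z}$ is the set of bi-infinite sequences all of whose finite subwords are allowed, and $\sigma$ is the left shift. $\theta$ is primitive if there is $k$ such that for all $a,a'\in\mathcal A$ the letter $a'$ occurs in $\theta^k(a)$. $\theta$ is aperiodic if $X_\theta$ contains no $\sigma$-periodic sequence; likewise a shift is aperiodic if it contains no $\sigma$-periodic sequence. If $\theta$ is primitive then $X_\theta=X_{\theta^n}$ for all $n\ge1$; replacing $\theta$ by a power if necessary, it is assumed that every $\theta$-periodic point is $\theta$-fixed. Factors. A shift factor of $(X,\sigma)$ is a shift $(Y,\sigma)$ with a continuous shift-commuting surjection $X\to Y$. A map is almost injective if it is somewhere injective (some point of the target has exactly one preimage). A system is almost automorphic if it is an almost injective extension of a group rotation. Height and pure base. For $\theta$ primitive and aperiodic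 there is a unique $h\ge1$ coprime to $\ell$ such that $(\varprojlim \mathbb Z/\ell^nh\mathbb Z,+1)$ is the maximal equicontinuous factor of $(X_\theta,\sigma)$; $h$ is the height of $\theta$. There is a clopen partition $X_\theta=\bigsqcup_{k\in\mathbb Z/h\mathbb Z}X_\theta^k$ with $\sigma(X^k_\theta)=X^{k+1}_\theta$ and $\theta(X^0_\theta)\subset X^0_\theta$, and a set $\mathcal A'\subset\mathcal A^h$ such that $X_\theta^0=\{x\in X_\theta: x_0\cdots x_{h-1}\in\mathcal A'\}$ (with $\mathcal A'$ consisting of the words $x_0\cdots x_{h-1}$, $x\in X^0_\theta$). The pure base of $\theta$ is the length-$\ell$ substitution $\tilde\theta$ on $\mathcal A'$ defined by: if $\theta(a_0\cdots a_{h-1})=a'_0\cdots a'_{h\ell-1}$ then $\tilde\theta_k(a_0\cdots a_{h-1})=a'_{kh}\cdots a'_{(k+1)h-1}$. If $h=1$ then $\tilde\theta=\theta$. Collaring. For $l,r\ge0$, $\theta^{(-l,r)}$ is the length-$\ell$ substitution whose alphabet is the set of allowed words $a_{-l}\cdots a_r$ of length $l+r+1$, with $\theta^{(-l,r)}_m(a_{-l}\cdots a_r)=a'_{m-l}\cdots a'_{m+r}$, where $a'_{-\ell l}\cdots a'_{\ell(r+1)-1}=\theta(a_{-l}\cdots a_r)$. Associated inner encoding. For a substitution $\zeta$ on alphabet $\mathcal A_\zeta$, let $S_\zeta$ be the semigroup (under composition) generated by its column maps, and $\ker S_\zeta$ its smallest two-sided ideal (the elements of minimal rank). Let $U_\zeta=\{\operatorname{im}f: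 f\in\ker S_\zeta\}$; if $\zeta$ is primitive, $U_\zeta$ covers $\mathcal A_\zeta$. The coincidence partition $\mathcal P_\zeta$ is the partition of $\mathcal A_\zeta$ whose members are the unions of the equivalence classes of $U_\zeta$ under the transitive closure of the relation $A\cap B\ne\emptyset$. For each $m$ and $A\in\mathcal P_\zeta$ there is $B\in\mathcal P_\zeta$ with $\zeta_m(A)\subset B$. The inner encoding associated to $\zeta$ is the substitution $\eta_\zeta$ on the alphabet $\mathcal P_\zeta$ with $(\eta_\zeta)_m(A)$ := the member of $\mathcal P_\zeta$ containing $\zeta_m(A)$. *)

(* Defs.v *)
From HB Require Import structures.
From mathcomp Require Import all_boot all_order all_algebra.
From mathcomp Require Import all_classical all_reals all_analysis.
From mathcomp Require Import zify.

Set Implicit Arguments.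
Unset Strict Implicit.
Unset Printing Implicit Defensive.
Import Order.TTheory GRing.Theory Num.Theory.
Local Open Scope classical_set_scope.
Local Open Scope ring_scope.

(* The two-sided full shift on a finite alphabet, with the product of the
   discrete topologies. *)
Definition fullshift (A : finType) := {ptws int -> discrete_topology A}.

Definition left_shift (A : finType) (x : fullshift A) : fullshift A :=
  fun i => x (i + 1).

Definition is_shift (A : finType) (Y : set (fullshift A)) : Prop :=
  closed Y /\ @left_shift A @` Y = Y.

Definition shift_periodic (A : finType) (x : fullshift A) : Prop :=
  exists2 p : nat, (0 < p)%N & iter p (@left_shift A) x = x.

Definition aperiodic (A : finType) (Y : set (fullshift A)) : Prop :=
  forall x, Y x -> ~ shift_periodic x.

(* A dynamical system is given by a subset [X] of a topological space and a
   self-map [f] of the ambient space, of which only the values on [X] matter. *)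
Definition factor_map (S T : topologicalType) (X : set S) (f : S -> S)
    (Y : set T) (g : T -> T) (p : S -> T) : Prop :=
  [/\ {within X, continuous p}, p @` X = Y
    & forall x, X x -> p (f x) = g (p x)].

Definition somewhere_injective (S T : Type) (X : set S) (Y : set T)
    (p : S -> T) : Prop :=
  exists2 y, Y y & exists! x, X x /\ p x = y.

Definition almost_automorphic (S : topologicalType) (X : set S) (f : S -> S)
    : Prop :=
  exists (G : topologicalZmodType) (g : G) (p : S -> G),
    [/\ compact [set: G], hausdorff_space G,
        factor_map X f [set: G] (fun z => z + g) p
      & somewhere_injective X [set: G] p].

Definition int_iter (T : Type) (f finv : T -> T) (n : int) : T -> T :=
  match n with Posz k => iter k f | Negz k => iter k.+1 finv end.

(* Equicontinuity on [K] of all the powers f^n, n in Z, of a bijection of [K]. *)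
Definition equicontinuous_system (E : uniformType) (K : set E) (f : E -> E)
    : Prop :=
  [/\ compact K, hausdorff_space E, f @` K = K
    & exists2 finv : E -> E, (forall x, K x -> finv (f x) = x)
      & forall x (V : set (E * E)), K x -> entourage V ->
          \forall y \near within K (nbhs x),
            forall n : int, V (int_iter f finv n x, int_iter f finv n y)].

Definition is_max_equicontinuous_factor (S : topologicalType) (X : set S)
    (f : S -> S) (E : uniformType) (K : set E) (g : E -> E) (p : S -> E)
    : Prop :=
  [/\ equicontinuous_system K g, factor_map X f K g p
    & forall (E' : uniformType) (K' : set E') (g' : E' -> E') (q : S -> E'),
        equicontinuous_system K' g' -> factor_map X f K' g' q ->
        exists2 r : E -> E', factor_map K g K' g' r
          & forall x, X x -> q x = r (p x)].

(* The inverse limit of the groups Z/l^n h, whose elements are represented by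
   their least nonnegative residues, and its translation by 1. *)
Definition odometer (l h : nat) : set {ptws nat -> nat} :=
  [set z | forall n, (z n < l ^ n * h)%N /\ z n.+1 %% (l ^ n * h) = z n]%N.

Definition odometer_succ (l h : nat) (z : {ptws nat -> nat})
    : {ptws nat -> nat} :=
  fun n => ((z n).+1 %% (l ^ n * h))%N.

Definition substitution (l : nat) (A : finType) := 'I_l -> A -> A.

Section Substitution.
Variables (l : nat) (A : finType) (theta : substitution l A).

Definition subst_letter (a : A) : l.-tuple A := [tuple theta m a | m < l].

Definition subst_word (w : seq A) : seq A :=
  flatten [seq tval (subst_letter a) | a <- w].

(* theta(u)_(i l + m) = theta_m(u_i) for 0 <= m < l; see [subst_seqE]. *)
Definition subst_seq (u : fullshift A) : fullshift A :=
  fun j => nth (u (j %/ l)%Z) (subst_letter (u (j %/ l)%Z)) `|(j %% l)%Z|.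

Definition allowed (w : seq A) : Prop :=
  exists (k : nat) (a : A), infix w (iter k subst_word [:: a]).

Definition subshift : set (fullshift A) :=
  [set x | forall (i : int) (n : nat), allowed [seq x (i + k%:Z) | k <- iota 0 n]].

Definition primitive : Prop :=
  exists k : nat, forall a a' : A, a' \in iter k subst_word [:: a].

Definition periodic_points_fixed : Prop :=
  forall (x : fullshift A) (n : nat),
    subshift x -> (0 < n)%N -> iter n subst_seq x = x -> subst_seq x = x.

Definition is_height (h : nat) : Prop :=
  [/\ (0 < h)%N, coprime h l
    & exists p : fullshift A -> {ptws nat -> nat},
        is_max_equicontinuous_factor subshift (@left_shift A)
          (odometer l h) (odometer_succ l h) p].

Definition init_word (n : nat) (x : fullshift A) : n.-tuple A :=
  [tuple x i%:Z | i < n].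

(* The partition indexed by Z/h is seen as an h-periodic sequence of sets. *)
Definition height_partition (h : nat) (P : nat -> set (fullshift A)) : Prop :=
  [/\ \bigcup_k P k = subshift,
      trivIset `I_h P /\ (forall k, P (k + h)%N = P k),
      (forall k, @clopen (subspace subshift) (P k)),
      (forall k, @left_shift A @` P k = P k.+1)
      /\ subst_seq @` P 0%N `<=` P 0%N
    & P 0%N = [set x | subshift x /\ (@init_word h @` P 0%N) (init_word h x)]].

(* The factor of length [n] of theta(w) that starts at position [off]. It is
   only used when this factor fits in theta(w), so that the default value of
   [nth] is irrelevant. *)
Definition block (n off : nat) (w : n.-tuple A) : n.-tuple A :=
  [tuple nth (tnth w i) (subst_word w) (off + i) | i < n].

Lemma subst_word_cons a w :
  subst_word (a :: w) = subst_letter a ++ subst_word w.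
Proof. by []. Qed.

Lemma size_subst_word w : size (subst_word w) = (l * size w)%N.
Proof.
elim: w => [|a w IH]; first by rewrite muln0.
by rewrite subst_word_cons size_cat size_tuple IH mulnS.
Qed.

Lemma subst_word_cat w1 w2 :
  subst_word (w1 ++ w2) = subst_word w1 ++ subst_word w2.
Proof. by rewrite /subst_word map_cat flatten_cat. Qed.

Lemma nth_subst_word d d' w j : (j < l * size w)%N ->
  nth d (subst_word w) j = nth d (subst_letter (nth d' w (j %/ l))) (j %% l).
Proof.
elim: w j => [|a w IH] j; first by rewrite muln0.
rewrite mulnS => jlt; have l0 : (0 < l)%N by move: jlt; rewrite lt0n; apply: contraTN => /eqP->.
rewrite subst_word_cons nth_cat size_tuple.
case: ltnP => jl; first by rewrite divn_small // modn_small.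
rewrite IH; last by rewrite ltn_subLR.
by rewrite -{3 4}(subnKC jl) modnDl divnDl // divnn l0.
Qed.

Lemma subst_seqE (u : fullshift A) (i : int) (m : 'I_l) :
  subst_seq u (i * l%:Z + m%:Z) = theta m (u i).
Proof.
have l0 : (0 < l)%N by exact: leq_ltn_trans (ltn_ord m).
have lz : l%:Z != 0 by rewrite eqz_nat -lt0n.
rewrite /subst_seq divzMDl // modzMDl divz_nat modz_nat.
rewrite divn_small // modn_small // addr0 /=.
by rewrite nth_mktuple.
Qed.

Lemma blockE n off (w : n.-tuple A) : (off + n <= l * n)%N ->
  block off w = take n (drop off (subst_word w)) :> seq A.
Proof.
move=> le; have sz : size (take n (drop off (subst_word w))) = n.
  rewrite size_take size_drop size_subst_word size_tuple.
  by case: ltnP => // ?; lia.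
case: n w le sz => [|n] w le sz; first by rewrite tuple0 take0.
apply: (@eq_from_nth _ (tnth w ord0)); rewrite size_tuple ?sz //.
move=> i ilt; rewrite nth_take // nth_drop.
have -> : i = Ordinal ilt by [].
rewrite nth_mktuple; apply: set_nth_default.
rewrite size_subst_word size_tuple; apply: leq_trans le.
by rewrite -addnS leq_add2l.
Qed.

Lemma allowed_block n off (w : n.-tuple A) : (off + n <= l * n)%N ->
  allowed w -> allowed (block off w).
Proof.
move=> le [k [a /infixP[s1 [s2 E]]]]; exists k.+1, a.
rewrite iterS E !subst_word_cat; apply: infix_catl; apply: infix_catr.
rewrite blockE //; apply: (infix_trans (infix_take _ _)); exact: infix_drop.
Qed.

Lemma init_word_block n off (x : fullshift A) : (off + n <= l * n)%N ->
  block off (init_word n x)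
  = init_word n (iter off (@left_shift A) (subst_seq x)).
Proof.
move=> le; apply: eq_from_tnth => i; rewrite !tnth_mktuple.
have shE : forall k (y : fullshift A) j,
    iter k (@left_shift A) y j = y (j + k%:Z).
  elim=> [|k IH] y j; first by rewrite addr0.
  by rewrite iterS /left_shift IH -addrA addrC -PoszD add1n addrC.
have lt : (off + i < l * n)%N.
  by apply: leq_trans le; rewrite -addnS leq_add2l.
have l0 : (0 < l)%N by case: (l) lt.
rewrite shE (@nth_subst_word _ (x 0)) ?size_tuple //.
have qlt : ((off + i) %/ l < n)%N by rewrite ltn_divLR // mulnC.
have -> : nth (x 0) (init_word n x) ((off + i) %/ l)
        = x ((off + i) %/ l)%N%:Z.
  have -> : ((off + i) %/ l)%N = Ordinal qlt by [].
  by rewrite nth_mktuple.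
have mlt : ((off + i) %% l < l)%N by rewrite ltn_mod.
have -> : ((off + i) %% l)%N = Ordinal mlt by [].
rewrite nth_mktuple -subst_seqE /=; congr (subst_seq _ _). lia.
Qed.

End Substitution.

Section PureBase.
Variables (l : nat) (A : finType) (theta : substitution l A).
Variables (h : nat) (P : nat -> set (fullshift A)).
Hypothesis partP : height_partition theta h P.

Definition pure_base_alphabet : finType :=
  {w : h.-tuple A | `[< (@init_word A h @` P 0%N) w >]}.

Lemma pure_base_subproof (k : 'I_l) (w : pure_base_alphabet) :
  `[< (@init_word A h @` P 0%N) (block theta (k * h) (val w)) >].
Proof.
case: partP => _ [_ Pper] _ [Psh Psub] _.
apply/asboolP; case: w => w /= /asboolP[x Px <-].
have Piter k' y : P 0%N y -> P k' (iter k' (@left_shift A) y).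
  elim: k' => // k' IH Py; rewrite -Psh; exists (iter k' (@left_shift A) y) => //.
  exact: IH.
have Pmul k' : P (k' * h)%N = P 0%N.
  by elim: k' => // k' IH; rewrite mulSn addnC Pper.
exists (iter (k * h) (@left_shift A) (subst_seq theta x)).
  by rewrite -(Pmul k); apply: Piter; apply: Psub; exists x.
rewrite init_word_block // addnC -mulSn leq_mul2r; apply/orP; right.
exact: ltn_ord.
Qed.

Definition pure_base : substitution l pure_base_alphabet :=
  fun k w => Sub (block theta (k * h) (val w)) (pure_base_subproof k w).

End PureBase.
Arguments pure_base {l A theta h P} partP k w.

Section Collaring.
Variables (l : nat) (A : finType) (theta : substitution l A) (L R : nat).

(* The letter a_j, -L <= j <= R, of such a word is its entry number j + L. *)
Definition collar_alphabet : finType :=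
  {w : (L + R).+1.-tuple A | `[< allowed theta w >]}.

Lemma collar_subproof (m : 'I_l) (w : collar_alphabet) :
  `[< allowed theta (block theta (l * L + m - L) (val w)) >].
Proof.
case: w => w /= /asboolP wP; apply/asboolP; apply: allowed_block => //.
have := ltn_ord m; move: (nat_of_ord m) => k klt; nia.
Qed.

(* a'_j, -l L <= j < l (R + 1), is the entry number j + l L of theta(w). *)
Definition collar : substitution l collar_alphabet :=
  fun m w => Sub (block theta (l * L + m - L) (val w)) (collar_subproof m w).

End Collaring.
Arguments collar {l A} theta L R m w.

Section InnerEncoding.
Variables (l : nat) (A : finType) (zeta : substitution l A).

Inductive column_semigroup : set (A -> A) :=
| column_semigroup_gen m : column_semigroup (zeta m)
| column_semigroup_comp f g :
    column_semigroup f -> column_semigroup g -> column_semigroup (f \o g).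

Definition two_sided_ideal (I : set (A -> A)) : Prop :=
  [/\ I !=set0, I `<=` column_semigroup
    & forall f g, column_semigroup f -> I g -> I (f \o g) /\ I (g \o f)].

Definition semigroup_kernel : set (A -> A) :=
  \bigcap_(I in two_sided_ideal) I.

Definition kernel_images : {set {set A}} :=
  [set B : {set A} |
    `[< exists2 f, semigroup_kernel f & B = (f @: [set: A])%SET >]]%SET.

Lemma kernel_imagesP (B : {set A}) :
  reflect (exists2 f, semigroup_kernel f & B = (f @: [set: A])%SET)
          (B \in kernel_images).
Proof. by rewrite inE; exact: asboolP. Qed.

Definition meets : rel {set A} := fun B C =>
  [&& B \in kernel_images, C \in kernel_images & B :&: C != finset.set0]%SET.

Definition coincidence_partition : {set {set A}} :=
  [set finset.cover [set C in kernel_images | connect meets B C]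
     | B in kernel_images]%SET.

Definition inner_alphabet : finType :=
  {B : {set A} | B \in coincidence_partition}.

Lemma inner_encoding_subproof (m : 'I_l) (B : inner_alphabet) :
  exists C : inner_alphabet, (zeta m @: val B)%SET \subset val C.
Proof.
have imU C : C \in kernel_images -> (zeta m @: C)%SET \in kernel_images.
  case/kernel_imagesP=> f kf ->; apply/kernel_imagesP; exists (zeta m \o f).
    move=> I II; have [_ _ cI] := II.
    by have [] := cI _ _ (column_semigroup_gen m) (kf I II).
  by rewrite imset_comp.
have immeets C D : meets C D -> meets (zeta m @: C)%SET (zeta m @: D)%SET.
  case/and3P=> CU DU /set0Pn[x]; rewrite inE => /andP[xC xD].
  rewrite /meets !imU //=; apply/set0Pn; exists (zeta m x).
  by rewrite inE !imset_f.
have imconn C D : connect meets C D ->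
    connect meets (zeta m @: C)%SET (zeta m @: D)%SET.
  move=> /connectP[p pP ->]; elim: p C pP => //= E p IH C /andP[CE pP].
  exact: connect_trans (connect1 (immeets _ _ CE)) (IH _ pP).
case: B => B /= /imsetP[B0 B0U ->].
have CP : finset.cover [set C in kernel_images | connect meets (zeta m @: B0)%SET C]%SET
    \in coincidence_partition by apply/imsetP; exists (zeta m @: B0)%SET; rewrite ?imU.
exists (exist (fun C => C \in coincidence_partition) _ CP) => /=.
apply/fintype.subsetP => y /imsetP[x].
case/bigcupP=> C; rewrite inE => /andP[CU BC] xC ->.
apply/bigcupP; exists (zeta m @: C)%SET; last exact: imset_f.
by rewrite inE imU //=; exact: imconn.
Qed.

Definition inner_encoding : substitution l inner_alphabet :=
  fun m B => xchoose (inner_encoding_subproof m B).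

Lemma inner_encodingP (m : 'I_l) (B : inner_alphabet) :
  (zeta m @: val B)%SET \subset val (inner_encoding m B).
Proof. exact: (xchooseP (inner_encoding_subproof m B)). Qed.

End InnerEncoding.
Arguments inner_encoding {l A} zeta m B.

(* Main.v *)
Require Import Defs.
From HB Require Import structures.
From mathcomp Require Import all_boot all_order all_algebra.
From mathcomp Require Import all_classical all_reals all_analysis.
From mathcomp Require Import fingroup perm zify ring.

Set Implicit Arguments.
Unset Strict Implicit.
Unset Printing Implicit Defensive.
Import Order.TTheory GRing.Theory Num.Theory.
Local Open Scope classical_set_scope.
Local Open Scope ring_scope.

(** Write [X] for the shift of [theta], [X0] for the piece [P 0] of the partition
    given by the height, [T] for the shift by [h] and [S] for [theta] as a map of
    sequences. Then [S] and [T] preserve [X0], [S T = T^l S], [T] is minimal on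
    [X0] ([base_minimal]), and every point of [X0] can be written [T^j S^n y] with
    [j < l^n] and [y] in [X0] ([base_desubst]). A coding is a map [L] on [X0] into
    the alphabet of a substitution [zeta] with [L (T^m S x) = zeta_m (L x)]. The
    pure base, its collared version and the inner encoding all are codings of
    [X0]; the words that are allowed for them are the words that they read along
    orbits of [T], and the elements of the column semigroup are the maps through
    which [L] sees [T^j S^k]. This translates the statement into one about [X0].

    Addresses in the odometer are related to the substitution as follows. Let [p]
    be the given factor map onto the odometer. Since [S^n T = T^(l^n) S^n] and
    [T] is minimal, the coordinate of [p] modulo [l^n h] is constant on [S^n X0]
    ([odometer_subst]). So the coordinates of [p x] reveal the numbers [j] with
    [x] in [T^j S^n X0], and points of [X0] that share these numbers have the same
    image under [p].

    Suppose that [q : X -> Y] is a factor map and that [Y] is almost automorphic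
    over a compact group. As [p] is maximal, the group is a factor of the odometer,
    so [q] is constant on some fiber of [p] ([constant_fiber]). By compactness the image
    under [q] of [T^z S^m x], for suitable large [m] and [z], is independent of
    [x] in [X0] on a long window ([constant_window]). If [S^n] is large compared
    with the range of [q], the block of [q (S^n x)] over the first letter of [x]
    depends only on the collared letter [L x]. For [f] in the kernel of the column
    semigroup, all of [im f] is read by the points [T^z S^m x] at one and the same
    place, because multiplying [f] on the right does not shrink its image; hence
    the block depends only on the class of [L x] in the coincidence partition
    ([block_class]). So a periodic point of the shift of the inner encoding is
    turned by this block code into a periodic point of [Y].

    Conversely a kernel element has its values in one class, so the inner encoding
    has a constant column. Iterating that column yields a point [x0] all of whose
    fiber under [p] reads the same sequence of classes ([inner_code_fiber]). The
    sequences of classes, with the height recorded as well, form a factor [Y] of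
    [X], which is aperiodic when the inner encoding is. Finally, any factor [q] of
    [X] that is constant on a fiber of [p] is almost automorphic
    ([almost_automorphic_constant_fiber]): by minimality the translations of the
    odometer that are realized by pairs of points with the same image under [q]
    form a closed subgroup, and [Y] is an almost injective extension of the
    quotient, which is an inverse limit of finite cyclic groups. *)

(** * Shifts and windows *)

Section FullShift.
Variable A : finType.
Implicit Types (x y : fullshift A) (a b i j : int).

Definition shift j x : fullshift A := fun i => x (i + j).

Definition agree a b x y := forall i, a <= i < b -> x i = y i.

Lemma shiftD i j x : shift i (shift j x) = shift (i + j) x.
Proof. by apply/funext => k; rewrite /shift addrA. Qed.

Lemma shift0 x : shift 0 x = x.
Proof. by apply/funext => k; rewrite /shift addr0. Qed.

Lemma eq_shift i j x : i = j -> shift i x = shift j x.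
Proof. by move=> ->. Qed.

Lemma shiftK j : cancel (@shift j) (@shift (- j)).
Proof. by move=> x; rewrite shiftD addNr shift0. Qed.

Lemma shiftNK j : cancel (@shift (- j)) (@shift j).
Proof. by move=> x; rewrite shiftD addrN shift0. Qed.

Lemma left_shiftE x : left_shift x = shift 1 x.
Proof. by []. Qed.

Lemma iter_left_shift n x : iter n (@left_shift A) x = shift n%:Z x.
Proof.
elim: n => [|n IH]; first by rewrite shift0.
by rewrite iterS IH left_shiftE shiftD -addn1 PoszD addrC.
Qed.

Lemma agree_sym a b x y : agree a b x y -> agree a b y x.
Proof. by move=> E i ilt; rewrite E. Qed.

Lemma agree_trans a b x y z : agree a b x y -> agree a b y z -> agree a b x z.
Proof. by move=> E F i ilt; rewrite E ?F. Qed.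

Lemma agreeW a b a' b' x y : a <= a' -> b' <= b ->
  agree a b x y -> agree a' b' x y.
Proof. by move=> la lb E i ilt; apply: E; lia. Qed.

Lemma agree_shift a b j x y :
  agree (a + j) (b + j) x y -> agree a b (shift j x) (shift j y).
Proof. by move=> E i ilt; apply: E; lia. Qed.

(** The windows around the origin generate the neighborhoods, since finitely many
    coordinates always lie in one such window. *)
Lemma nbhs_fullshift x (U : set (fullshift A)) :
  nbhs x U <-> exists N : nat, forall y, agree (- N%:Z) N%:Z x y -> U y.
Proof.
split.
  pose F : set_system (fullshift A) :=
    [set V | exists N : nat, forall y, agree (- N%:Z) N%:Z x y -> V y].
  have FF : Filter F.
    split; first by exists 0%N.
      move=> V W [N VN] [M WM]; exists (maxn N M) => y E.
      by split; [apply: VN|apply: WM]; apply: agreeW E; lia.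
    by move=> V W VW [N VN]; exists N => y /VN /VW.
  suff Fx : F --> x by move=> Ux; exact: (Fx U Ux).
  apply/cvg_sup => i V [W [[D oD <-]] Dx WV].
  apply: (filterS WV); exists (`|i|%N.+1) => y E /=.
  by rewrite -E //; lia.
case=> N NU; apply: (filterS NU).
have nbi (i : int) : nbhs x [set y : fullshift A | x i = y i].
  have nx := @discrete_set1 (discrete_topology A) (x i).
  have pc := @proj_continuous int (fun _ => discrete_topology A) i x.
  have cx : nbhs x [set y : fullshift A | y i = x i] by exact (pc _ nx).
  by apply: filterS cx => y /= ->.
have : forall n : nat, nbhs x [set y : fullshift A |
    forall k : nat, (k < n)%N -> x (k%:Z - N%:Z) = y (k%:Z - N%:Z)].
  elim=> [|n IH]; first by apply: filterS (nbi 0).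
  apply: filterS (filterI IH (nbi (n%:Z - N%:Z))) => y [E En] k.
  by rewrite ltnS leq_eqVlt => /orP[/eqP ->|/E].
move=> /(_ (N + N)%N); apply: filterS => y E i ilt; have := E (absz (i + N%:Z)).
rewrite (_ : (absz (i + N%:Z))%:Z - N%:Z = i); last lia.
by apply; lia.
Qed.

Lemma nbhs_agree x (N : nat) :
  nbhs x [set y : fullshift A | agree (- N%:Z) N%:Z x y].
Proof. by apply/nbhs_fullshift; exists N. Qed.

Lemma closed_fullshiftP (Y : set (fullshift A)) :
  closed Y <-> forall x,
    (forall N : nat, exists2 y, Y y & agree (- N%:Z) N%:Z x y) -> Y x.
Proof.
split=> [cY x xY|H x xY].
  apply: cY => U /nbhs_fullshift[N NU].
  by have [y Yy /NU Uy] := xY N; exists y.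
apply: H => N; have [y [Yy xy]] := xY _ (nbhs_agree x N).
by exists y.
Qed.

Lemma closed_agree (Y : set (fullshift A)) x : closed Y ->
  (forall N : nat, exists2 y, Y y & agree (- N%:Z) N%:Z x y) -> Y x.
Proof. by move=> /closed_fullshiftP; apply. Qed.

Lemma compact_fullshift : compact [set: fullshift A].
Proof.
have := @tychonoff int (fun _ => discrete_topology A) (fun _ => setT).
have Ac : compact [set: discrete_topology A].
  exact (@finite_compact (discrete_topology A) setT (@finite_finset A setT)).
move=> /(_ (fun _ => Ac)).
suff -> : [set f : int -> discrete_topology A | forall i, setT (f i)] = setT by [].
by apply/seteqP; split.
Qed.

Lemma hausdorff_fullshift : hausdorff_space (fullshift A).
Proof.
apply: (@hausdorff_product int (fun _ => discrete_topology A)) => i.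
exact: discrete_hausdorff.
Qed.

(** Compactness, in the form of convergence along a subsequence. *)
Lemma cluster_seq (u : nat -> fullshift A) :
  exists x, forall N M : nat, exists2 n, (M <= n)%N & agree (- N%:Z) N%:Z x (u n).
Proof.
have [x [_ xu]] := @compact_fullshift (u @ \oo) _ filterT.
exists x => N M.
have := xu [set u n | n in [set n | (M <= n)%N]] _ _ (nbhs_agree x N).
case; first by exists M => // n Mn; exists n.
by move=> _ [[n Mn <-] xn]; exists n.
Qed.

Lemma within_agree (T : topologicalType) (X : set (fullshift A))
    (p : fullshift A -> T) x (U : set T) :
  {within X, continuous p} -> X x -> nbhs (p x) U ->
  exists N : nat, forall y, X y -> agree (- N%:Z) N%:Z x y -> U (p y).
Proof.
move=> /subspace_continuousP pc Xx /(pc x Xx) /nbhs_fullshift[N NU].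
by exists N => y Xy /NU; apply.
Qed.

Lemma within_agreeP (T : topologicalType) (X : set (fullshift A))
    (p : fullshift A -> T) :
  (forall x (U : set T), X x -> nbhs (p x) U ->
   exists N : nat, forall y, X y -> agree (- N%:Z) N%:Z x y -> U (p y)) ->
  {within X, continuous p}.
Proof.
move=> H; apply/subspace_continuousP => x Xx U Ux.
have [N NU] := H _ _ Xx Ux.
by apply/nbhs_fullshift; exists N => y xy Xy; exact: NU.
Qed.

Lemma within_coord (I : eqType) (D : discreteTopologicalType)
    (X : set (fullshift A)) (p : fullshift A -> {ptws I -> D}) x (k : I) :
  {within X, continuous p} -> X x ->
  exists N : nat, forall y, X y -> agree (- N%:Z) N%:Z x y -> p y k = p x k.
Proof.
move=> pc Xx; have nx := @discrete_set1 D (p x k).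
have pr := @proj_continuous I (fun _ => D) k (p x).
have cx : nbhs (p x) [set z : {ptws I -> D} | z k = p x k] by exact (pr _ nx).
have [N NP] := within_agree pc Xx cx.
by exists N.
Qed.

End FullShift.

(** The theorem of Curtis, Hedlund and Lyndon. If no radius worked, a limit of
    the counterexamples for larger and larger radii would contradict continuity. *)
Lemma sliding_block (A B : finType) (X : set (fullshift A))
    (q : fullshift A -> fullshift B) :
  closed X -> {within X, continuous q} ->
  exists r : nat, forall x y, X x -> X y ->
    agree (- r%:Z) r%:Z x y -> q x 0 = q y 0.
Proof.
move=> cX qc; apply: contrapT => H.
have {H} : forall n : nat, exists xy : fullshift A * fullshift A,
    [/\ X xy.1, X xy.2, agree (- n%:Z) n%:Z xy.1 xy.2 & q xy.1 0 != q xy.2 0].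
  move=> n; apply: contrapT => E; apply: H; exists n => x y Xx Xy xy.
  by apply/eqP/negPn/negP => qxy; apply: E; exists (x, y).
move=> /choice[u uP].
have [x xP] := cluster_seq (fun n => (u n).1).
have Xx : X x.
  apply: closed_agree cX _ => N; have [n _ xn] := xP N 0%N.
  by exists (u n).1 => //; case: (uP n).
have [N NP] := within_coord 0 qc Xx.
have [n nN xn] := xP N N.
have [X1 X2 u12 /eqP] := uP n; apply.
rewrite NP // NP //; apply: agree_trans xn _.
by apply: agreeW u12; lia.
Qed.

(** * Words of sequences and substitutions *)

Definition word (A : finType) (x : fullshift A) (i : int) (n : nat) : seq A :=
  [seq x (i + k%:Z) | k <- iota 0 n].

Section Words.
Variable A : finType.
Implicit Types (x y : fullshift A) (i j : int) (w : seq A).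

Lemma size_word x i n : size (word x i n) = n.
Proof. by rewrite size_map size_iota. Qed.

Lemma nth_word a x i n k : (k < n)%N -> nth a (word x i n) k = x (i + k%:Z).
Proof.
by move=> kn; rewrite (nth_map 0%N) ?size_iota // nth_iota.
Qed.

Lemma word_cat x i m n : word x i (m + n) = word x i m ++ word x (i + m%:Z) n.
Proof.
rewrite /word iotaD map_cat add0n -{2}[m]addn0 iotaDl -map_comp.
by congr (_ ++ _); apply: eq_map => k /=; rewrite PoszD addrA.
Qed.

Lemma infix_word x i m i' m' : i <= i' -> i' + m'%:Z <= i + m%:Z ->
  infix (word x i' m') (word x i m).
Proof.
move=> ii im; pose a := absz (i' - i); pose b := (m - a - m')%N.
have -> : m = (a + (m' + b))%N by rewrite /b /a; lia.
rewrite !word_cat.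
have -> : i + a%:Z = i' by rewrite /a; lia.
exact: infix_infix.
Qed.

Lemma infix_wordP w x i n : infix w (word x i n) ->
  exists2 k : nat, (k + size w <= n)%N & w = word x (i + k%:Z) (size w).
Proof.
move=> /infixP[s1 [s2 E]].
have sz : n = (size s1 + (size w + size s2))%N.
  by rewrite -(size_word x i n) E !size_cat.
exists (size s1); first by rewrite sz addnA leq_addr.
move: E; rewrite {1}sz !word_cat => /eqP.
rewrite eqseq_cat ?size_word // => /andP[_].
by rewrite eqseq_cat ?size_word // => /andP[/eqP].
Qed.

Lemma word_agree x y i j n :
  word x i n = word y j n -> agree i (i + n%:Z) x (shift (j - i) y).
Proof.
move=> E k ilt; rewrite /shift.
have kn : (absz (k - i) < n)%N by lia.
have := congr1 (fun w => nth (x k) w (absz (k - i))) E.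
rewrite !nth_word //.
have -> : i + (absz (k - i))%:Z = k by lia.
by move=> ->; congr (y _); lia.
Qed.

Lemma agree_word x y i j n :
  agree i (i + n%:Z) x (shift (j - i) y) -> word x i n = word y j n.
Proof.
move=> E; apply/eq_in_map => k; rewrite mem_iota => /= klt.
by rewrite E /shift; [congr (y _); lia|lia].
Qed.

Lemma word_eqP x y i j n :
  (forall k : nat, (k < n)%N -> x (i + k%:Z) = y (j + k%:Z)) ->
  word x i n = word y j n.
Proof. by move=> E; apply/eq_in_map => k; rewrite mem_iota => /= /E. Qed.

End Words.

Section Substitution.
Variables (l : nat) (A : finType) (theta : substitution l A).
Hypothesis l_gt1 : (1 < l)%N.
Implicit Types (x y : fullshift A) (i j a b : int) (w : seq A).
Local Notation S := (subst_seq theta).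
Local Notation subw := (subst_word theta).

Lemma expl_gt k : (k < l ^ k)%N.
Proof. exact: ltn_expl. Qed.

Lemma expl_gt0 k : (0 < l ^ k)%N.
Proof. exact: leq_ltn_trans (expl_gt k). Qed.

Lemma int_divl j : exists i (m : 'I_l), j = i * l%:Z + m%:Z.
Proof.
have mlt : (absz (j %% l%:Z)%Z < l)%N by have := @ltz_mod j l%:Z; lia.
exists (j %/ l)%Z, (Ordinal mlt) => /=.
by rewrite {1}(divz_eq j l); congr (_ + _); have := @modz_ge0 j l%:Z; lia.
Qed.

Lemma subst_seqP x y :
  (forall i (m : 'I_l), y (i * l%:Z + m%:Z) = theta m (x i)) -> y = S x.
Proof.
move=> E; apply/funext => j; have [i [m ->]] := int_divl j.
by rewrite E subst_seqE.
Qed.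

Lemma subst_shift j x : S (shift j x) = shift (l%:Z * j) (S x).
Proof.
apply/esym/subst_seqP => i m; rewrite /shift -subst_seqE; congr (S x _); lia.
Qed.

Lemma iter_subst_shift n j x :
  iter n S (shift j x) = shift ((l ^ n)%N%:Z * j) (iter n S x).
Proof.
elim: n => [|n IH]; first by rewrite mul1r.
by rewrite !iterS IH subst_shift mulrA -PoszM -expnS.
Qed.

Lemma subst_agree a b x y :
  agree a b x y -> agree (l%:Z * a) (l%:Z * b) (S x) (S y).
Proof.
move=> E j; have [i [m ->]] := int_divl j => jlt.
rewrite !subst_seqE E //; have := ltn_ord m.
by move: (nat_of_ord m) jlt => k jlt klt; apply/andP; split; nia.
Qed.

Lemma iter_subst_agree n a b x y : agree a b x y ->
  agree ((l ^ n)%N%:Z * a) ((l ^ n)%N%:Z * b) (iter n S x) (iter n S y).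
Proof.
elim: n => [|n IH] E; first by rewrite !mul1r.
by rewrite !iterS expnS PoszM -!mulrA; apply: subst_agree; exact: IH.
Qed.

Lemma subst_word_word x i n :
  subw (word x i n) = word (S x) (l%:Z * i) (l * n).
Proof.
apply: (@eq_from_nth _ (x 0)); first by rewrite size_subst_word !size_word.
rewrite size_subst_word size_word => k kn.
have l0 : (0 < l)%N by lia.
have qlt : (k %/ l < n)%N by rewrite ltn_divLR // mulnC.
rewrite (@nth_subst_word _ _ _ _ (x 0)) ?size_word // !nth_word //.
have mlt : (k %% l < l)%N by rewrite ltn_mod.
have -> : (k %% l)%N = Ordinal mlt by [].
rewrite nth_mktuple -subst_seqE /=; congr (S x _).
rewrite {3}(divn_eq k l) PoszD PoszM; lia.
Qed.

Lemma iter_subst_word_word k x i n :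
  iter k subw (word x i n) = word (iter k S x) ((l ^ k)%N%:Z * i) (l ^ k * n).
Proof.
elim: k => [|k IH]; first by rewrite mul1r mul1n.
by rewrite !iterS IH subst_word_word expnS PoszM -mulrA -mulnA.
Qed.

Lemma iter_subst_letter k x :
  iter k subw [:: x 0] = word (iter k S x) 0 (l ^ k).
Proof.
have -> : [:: x 0] = word x 0 1 by rewrite /word /= addr0.
by rewrite iter_subst_word_word mulr0 muln1.
Qed.

Lemma infix_subst k w1 w2 :
  infix w1 w2 -> infix (iter k subw w1) (iter k subw w2).
Proof.
elim: k => // k IH /IH /infixP[s1 [s2 E]]; rewrite !iterS E !subst_word_cat.
exact: infix_infix.
Qed.

Lemma allowed_infix w1 w2 : infix w1 w2 -> allowed theta w2 -> allowed theta w1.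
Proof.
by move=> w12 [k [a w2a]]; exists k, a; exact: infix_trans w12 w2a.
Qed.

Lemma subshift_word x i n : subshift theta x -> allowed theta (word x i n).
Proof. exact. Qed.

Lemma subshift_shift j x : subshift theta x -> subshift theta (shift j x).
Proof.
move=> Xx i n; have := Xx (i + j) n; congr (allowed _ _).
by apply: eq_map => k; rewrite /shift addrAC.
Qed.

Lemma subshift_closed : closed (subshift theta).
Proof.
apply/closed_fullshiftP => x xX i n.
have [y Xy xy] := xX (`|i| + n).+1%N.
have := Xy i n; congr (allowed _ _); apply/eq_in_map => k.
by rewrite mem_iota => /= klt; rewrite xy //; lia.
Qed.

Lemma subshiftP x : subshift theta x <->
  forall N : nat, allowed theta (word x (- N%:Z) (N + N)).
Proof.
split=> [Xx N|H i n]; first exact: Xx.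
apply: allowed_infix (H (`|i| + n).+1%N); apply: infix_word; lia.
Qed.

(** If [w] occurs in the image of [a] under a power of the substitution, and [a]
    in the image of every letter under another power, then [w] occurs in the
    image of every letter under the product of these, and under larger powers. *)
Lemma primitive_word w : primitive theta -> allowed theta w ->
  exists k0 : nat, forall k, (k0 <= k)%N -> forall y,
  exists2 j : nat, (j + size w <= l ^ k)%N & w = word (iter k S y) j%:Z (size w).
Proof.
move=> [k2 prim] [k1 [a wa]]; exists (k1 + k2)%N => k kk y.
pose k3 := (k - (k1 + k2))%N.
have -> : k = (k1 + (k2 + k3))%N by rewrite /k3; lia.
suff /infix_wordP[j jw E] :
    infix w (word (iter (k1 + (k2 + k3)) S y) 0 (l ^ (k1 + (k2 + k3)))).
  by exists j => //; rewrite {1}E add0r.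
rewrite -iter_subst_letter !iterD.
apply: infix_trans wa _; apply: infix_subst.
have /infix_trans -> // : infix [:: a] (iter k2 subw [:: iter k3 S y 0]).
  by rewrite infix1s.
apply: infix_subst; rewrite infix1s iter_subst_letter.
apply/mapP; exists 0%N; last by rewrite addr0.
by rewrite mem_iota expl_gt0.
Qed.

End Substitution.

(** * The kernel of the column semigroup *)

Section Kernel.
Variables (l : nat) (Z : finType) (zeta : substitution l Z).
Hypothesis l_gt0 : (0 < l)%N.
Implicit Types f g : Z -> Z.
Local Notation SG := (column_semigroup zeta).
Local Notation ker := (semigroup_kernel zeta).
Local Notation K := (kernel_images zeta).

Definition rank f := #|(f @: [set: Z])%SET|.

Definition minimal_rank f := SG f /\ forall g, SG g -> (rank f <= rank g)%N.

Lemma rank_comp_l f g : (rank (f \o g) <= rank f)%N.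
Proof.
by apply/subset_leq_card/fintype.subsetP => _ /imsetP[x _ ->]; exact: imset_f.
Qed.

Lemma rank_comp_r f g : (rank (f \o g) <= rank g)%N.
Proof. by rewrite /rank imset_comp; exact: leq_imset_card. Qed.

Lemma minimal_rank_exists : exists f, minimal_rank f.
Proof.
have E : exists n, `[< exists2 f, SG f & rank f = n >].
  exists (rank (zeta (Ordinal l_gt0))); apply/asboolP.
  by exists (zeta (Ordinal l_gt0)) => //; constructor.
case: (ex_minnP E) => n /asboolP[f Sf fn] nmin; exists f; split=> // g Sg.
by rewrite fn; apply: nmin; apply/asboolP; exists g.
Qed.

Lemma minimal_rank_ideal : two_sided_ideal zeta minimal_rank.
Proof.
split; first exact: minimal_rank_exists.
  by move=> f [].
move=> f g Sf [Sg gmin]; split; split; try by constructor.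
  by move=> g' /gmin; apply: leq_trans; exact: rank_comp_r.
by move=> g' /gmin; apply: leq_trans; exact: rank_comp_l.
Qed.

(** Multiplying an element of minimal rank on the right cannot shrink its image. *)
Lemma minimal_rank_image f g :
  minimal_rank f -> SG g -> ((f \o g) @: [set: Z] = f @: [set: Z])%SET.
Proof.
move=> [Sf fmin] Sg; apply/eqP; rewrite eqEcard; apply/andP; split.
  by apply/fintype.subsetP => _ /imsetP[x _ ->]; exact: imset_f.
by apply: fmin; constructor.
Qed.

(** If [f] has minimal rank and [g] lies in an ideal, then [f \o g] permutes
    the image of [f], so that some power of it fixes that image pointwise; this
    writes [f] as a product that involves [g]. *)
Lemma minimal_rank_kernel f : minimal_rank f -> ker f.
Proof.
move=> fmin J [[g Jg] JS Jideal]; have [Sf _] := fmin; have Sg := JS _ Jg.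
pose u := f \o g; have Ju : J u by case: (Jideal f g).
pose B := (f @: [set: Z])%SET.
have uB : (u @: B)%SET = B.
  rewrite -imset_comp; apply: (minimal_rank_image fmin (g := g \o f)).
  by constructor.
have u_inj : {in B &, injective u} by apply/imset_injP; rewrite uB.
have uBP x : x \in B -> u x \in B by move=> xB; rewrite -uB imset_f.
(* [u] need not be injective outside [B], so it is replaced there by the identity. *)
pose v x := if x \in B then u x else x.
have v_inj : injective v.
  move=> x y; rewrite /v; case: ifP => xB; case: ifP => yB //.
  - exact: u_inj.
  - by move=> E; move: (uBP _ xB); rewrite E yB.
  - by move=> E; move: (uBP _ yB); rewrite -E xB.
pose s := perm v_inj; pose n := #[s]%g.
have uv k x : x \in B -> iter k u x = iter k v x /\ iter k u x \in B.
  move=> xB; elim: k => // k [E Eb]; rewrite !iterS -E /v Eb.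
  by split=> //; exact: uBP.
have un x : x \in B -> iter n u x = x.
  move=> xB; rewrite (uv n x xB).1.
  have := permX s x n; rewrite expg_order perm1 => {2}->.
  by apply: eq_iter => y; rewrite permE.
have Jn k : J (iter k.+1 u).
  elim: k => // k IH; rewrite (_ : iter _ _ = u \o iter k.+1 u) //.
  by case: (Jideal u (iter k.+1 u) (JS _ Ju) IH).
have -> : f = iter n u \o f.
  by apply/funext => x /=; rewrite un // imset_f.
have n0 : (0 < n)%N by exact: order_gt0.
rewrite -(prednK n0).
by case: (Jideal f (iter n.-1.+1 u) Sf (Jn _)).
Qed.

Lemma kernelP f : ker f <-> minimal_rank f.
Proof.
by split; [apply; exact: minimal_rank_ideal|exact: minimal_rank_kernel].
Qed.

Lemma kernel_images_nonempty : exists2 f, ker f & (f @: [set: Z])%SET \in K.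
Proof.
have [f fmin] := minimal_rank_exists; exists f; first exact/kernelP.
by apply/kernel_imagesP; exists f => //; exact/kernelP.
Qed.

Lemma kernel_comp_l f g : SG f -> ker g -> ker (f \o g).
Proof.
move=> Sf /kernelP gk; apply/kernelP.
by have [_ _ /(_ f g Sf gk)[]] := minimal_rank_ideal.
Qed.

Local Notation meets := (Defs.meets zeta).
Local Notation partition := (coincidence_partition zeta).

Lemma connect_meets_sym : connect_sym meets.
Proof.
apply: sym_connect_sym => B C; rewrite /Defs.meets finset.setIC.
by rewrite andbCA.
Qed.

Lemma coincidence_class_uniq B C a :
  B \in partition -> C \in partition -> a \in B -> a \in C -> B = C.
Proof.
move=> /imsetP[B0 _ ->] /imsetP[C0 _ ->] /bigcupP[B']; rewrite inE.
move=> /andP[KB' BB'] aB' /bigcupP[C']; rewrite inE => /andP[KC' CC'] aC'.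
have BC : connect meets B' C'.
  apply: connect1; rewrite /Defs.meets KB' KC' /=.
  by apply/set0Pn; exists a; rewrite inE aB'.
have BC0 : connect meets B0 C0.
  by apply: connect_trans BB' _; apply: connect_trans BC _; rewrite connect_meets_sym.
congr finset.cover; apply/setP => D; rewrite !inE; congr (_ && _).
exact: (same_connect connect_meets_sym BC0).
Qed.

Lemma kernel_image_class B : B \in K ->
  exists2 C, C \in partition & B \subset C.
Proof.
move=> KB; exists (finset.cover [set C in K | connect meets B C]%SET).
  by apply/imsetP; exists B.
apply/fintype.subsetP => x xB; apply/bigcupP; exists B => //.
by rewrite inE KB connect0.
Qed.

Lemma coincidence_class_nonempty (z : Z) B : B \in partition ->
  exists a, a \in B.
Proof.
move=> /imsetP[B0 KB0 ->]; case/kernel_imagesP: (KB0) => f _ Bf.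
exists (f z); apply/bigcupP; exists B0; first by rewrite inE KB0 connect0.
by rewrite Bf imset_f.
Qed.

(** A transitive relation that holds on every image of the kernel holds on
    every class, since the classes are the chains of overlapping images. *)
Lemma coincidence_class_ind (R : Z -> Z -> Prop) :
  (forall a b c, R a b -> R b c -> R a c) ->
  (forall C, C \in K -> forall a b, a \in C -> b \in C -> R a b) ->
  forall B, B \in partition -> forall a b, a \in B -> b \in B -> R a b.
Proof.
move=> Rt RK B /imsetP[B0 _ ->] a b /bigcupP[C]; rewrite inE.
move=> /andP[KC BC] aC /bigcupP[D]; rewrite inE => /andP[KD BD] bD.
have : connect meets C D by apply: connect_trans BD; rewrite connect_meets_sym.
move=> /connectP[p pP E]; rewrite {}E in KD bD {BD}.
elim: p a C KC BC aC pP KD bD => [|C' p IH] a C KC BC aC /=.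
  by move=> _ _ bC; exact: RK KC _ _ aC bC.
move=> /andP[/and3P[_ KC' /set0Pn[c]]]; rewrite inE => /andP[cC cC'] pP KD bD.
apply: Rt (RK _ KC _ _ aC cC) _; apply: (IH c C') => //.
apply: connect_trans BC (connect1 _).
by rewrite /Defs.meets KC KC'; apply/set0Pn; exists c; rewrite inE cC.
Qed.

End Kernel.

(** * Compact groups as uniform spaces *)

(** A copy of the group, to carry the uniform structure of a topological group. *)
Definition group_uniform (G : topologicalZmodType) : Type := G.

Section GroupUniform.
Variable G : topologicalZmodType.
Implicit Types (x y : G) (U : set G).

Lemma nbhs_addr x y U : nbhs (x + y) U -> nbhs x [set z | U (z + y)].
Proof.
move=> xyU.
have : {for x, continuous (fun z => z + y)}.
  apply: (@continuous_comp _ _ _ (fun z => (z, y)) (fun z : G * G => z.1 + z.2)).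
    by apply: cvg_pair => /=; [exact: cvg_id|exact: cvg_cst].
  exact: add_continuous.
exact.
Qed.

Lemma nbhs_translate x U : nbhs x U <-> nbhs (0 : G) [set z | U (z + x)].
Proof.
split=> [xU|oU]; first by apply: nbhs_addr; rewrite add0r.
have := @nbhs_addr x (- x) [set z | U (z + x)].
rewrite subrr => /(_ oU); apply: filterS => z /=.
by rewrite subrK.
Qed.

Definition group_entourage : set_system (G * G) :=
  [set E | exists2 U, nbhs (0 : G) U & forall x y, U (y - x) -> E (x, y)].

Lemma group_entourage_filter : Filter group_entourage.
Proof.
split; first by exists setT => //; exact: filterT.
  move=> E F [U oU UE] [V oV VF]; exists (U `&` V); first exact: filterI.
  by move=> x y [/UE ? /VF ?].
by move=> E F EF [U oU UE]; exists U => // x y /UE /EF.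
Qed.

Lemma group_entourage_diagonal E : group_entourage E -> diagonal `<=` E.
Proof.
move=> [U oU UE] [x y]; rewrite /diagonal /= => ->; apply: UE; rewrite subrr.
exact: nbhs_singleton oU.
Qed.

Lemma group_entourage_inv E :
  group_entourage E -> group_entourage (E^-1)%relation.
Proof.
move=> [U oU UE]; exists [set z | U (- z)].
  have := @opp_continuous G 0; rewrite /continuous_at oppr0; exact.
by move=> x y /=; rewrite opprB => /UE.
Qed.

Lemma group_entourage_split E : group_entourage E ->
  exists2 F, group_entourage F & (F \; F `<=` E)%relation.
Proof.
move=> [U oU UE].
have : nbhs ((0 : G), (0 : G)) [set z : G * G | U (z.1 + z.2)].
  have := @add_continuous G (0, 0); rewrite /continuous_at /= addr0; exact.
move=> [[V W] [/= oV oW] VW].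
exists [set xy : G * G | (V `&` W) (xy.2 - xy.1)].
  by exists (V `&` W) => //; exact: filterI.
move=> [x y] /= [z [/= Vxz _] [_ /= Wzy]]; apply: UE.
have := VW (z - x, y - z) (conj Vxz Wzy); rewrite /= addrC addrA.
by rewrite subrK.
Qed.

Lemma group_nbhsE : nbhs = nbhs_ group_entourage.
Proof.
apply/funext => x; apply/seteqP; split=> U.
  move=> /nbhs_translate oU; exists [set xy : G * G | U (xy.2 - xy.1 + x)].
    by exists [set z | U (z + x)].
  by move=> y /xsectionP /=; rewrite subrK.
move=> [E [V oV VE] EU]; apply/nbhs_translate; apply: filterS oV => z Vz.
by apply: EU; apply/xsectionP; apply: VE; rewrite addrK.
Qed.

Local Notation gU := (group_uniform G).

HB.instance Definition _ := Topological.copy gU G.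

HB.instance Definition _ := @Nbhs_isUniform.Build gU group_entourage
  group_entourage_filter group_entourage_diagonal group_entourage_inv
  group_entourage_split group_nbhsE.

(** A rotation preserves the differences of points, hence its powers form an
    equicontinuous family. *)
Lemma rotation_equicontinuous (g : G) : compact [set: G] -> hausdorff_space G ->
  equicontinuous_system [set: gU] (fun z : G => z + g).
Proof.
move=> cG hG; split=> //.
  by apply/seteqP; split=> // z _; exists (z - g) => //; rewrite subrK.
exists (fun z : G => z - g) => [x _|x V _ VE]; first exact: addrK.
have iterD k (a z : G) : iter k (fun z => z + a) z = z + a *+ k.
  by elim: k => [|k /= ->]; rewrite ?addr0 // mulrSr addrA.
have rotD n : exists a : G, forall z,
    int_iter (fun z : G => z + g) (fun z : G => z - g) n z = z + a.
  case: n => k; first by exists (g *+ k) => z; exact: iterD.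
  by exists ((- g) *+ k.+1) => z; exact: (iterD k.+1).
have [U oU UV] : group_entourage V := VE.
have xU : nbhs x [set y : G | U (y - x)].
  by apply/nbhs_translate; apply: filterS oU => z /=; rewrite addrK.
apply: filterS xU => y Uy _ n; have [a aP] := rotD n; rewrite !aP.
by apply: UV; rewrite opprD addrACA subrr addr0.
Qed.

End GroupUniform.

(** * Procyclic groups *)

(** Quotients of an odometer by closed subgroups are inverse limits of finite
    cyclic groups along such sequences of orders. *)
Record scale := Scale {
  period :> nat -> nat;
  period_gt0 : forall n, (0 < period n)%N;
  period_dvd : forall n, (period n %| period n.+1)%N }.

(** Elements of the inverse limit of the groups Z/d_n, given by their least
    nonnegative residues. *)
Record procyclic (d : scale) := Procyclic {
  residue :> nat -> nat;
  residueP : forall n, (residue n < d n /\ residue n.+1 %% d n = residue n)%N }.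

Section Procyclic.
Variable d : scale.
Local Notation G := (procyclic d).
Implicit Types z w : G.
Local Open Scope nat_scope.

HB.instance Definition _ := gen_eqMixin G.
HB.instance Definition _ := gen_choiceMixin G.

Lemma procyclic_eq z w : residue z =1 residue w -> z = w.
Proof.
case: z w => [z zP] [w wP] /= /funext E; case: _ / E in wP *.
by congr Procyclic; exact: Prop_irrelevance.
Qed.

Lemma residue_mod z n : z n %% d n = z n.
Proof. by rewrite modn_small //; case: (residueP z n). Qed.

Lemma residue_le z w m n :
  (m <= n)%N -> z n = w n -> z m = w m.
Proof.
move=> /subnKC <-; elim: (n - m)%N => [|k IH]; first by rewrite addn0.
rewrite addnS => E; apply: IH.
by have [_ <-] := residueP z (m + k); have [_ <-] := residueP w (m + k); rewrite E.
Qed.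

Lemma procyclic_subproof (f : nat -> nat) :
  (forall n, f n.+1 = f n %[mod d n]) ->
  forall n, (f n %% d n < d n)%N /\ (f n.+1 %% d n.+1) %% d n = f n %% d n.
Proof.
move=> fP n; split; first by rewrite ltn_mod period_gt0.
by rewrite modn_dvdm ?fP // period_dvd.
Qed.

Definition procyclic_of f fP := @Procyclic d _ (@procyclic_subproof f fP).

Lemma zero_subproof n : (fun=> 0%N) n.+1 = (fun=> 0%N) n %[mod d n].
Proof. by []. Qed.

Lemma one_subproof n : (fun=> 1%N) n.+1 = (fun=> 1%N) n %[mod d n].
Proof. by []. Qed.

Lemma add_subproof z w n : z n.+1 + w n.+1 = z n + w n %[mod d n].
Proof.
rewrite -modnDm; have [_ ->] := residueP z n; have [_ ->] := residueP w n.
by [].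
Qed.

Lemma opp_subproof z n : d n.+1 - z n.+1 = d n - z n %[mod d n].
Proof.
apply/eqP; rewrite -(eqn_modDr (z n.+1)) subnK; last first.
  by apply: ltnW; case: (residueP z n.+1).
rewrite -modnDmr; have [zlt ->] := residueP z n.
by rewrite subnK 1?ltnW // modnn; exact: period_dvd.
Qed.

Definition procyclic_zero : G := procyclic_of zero_subproof.
Definition procyclic_one : G := procyclic_of one_subproof.
Definition procyclic_add z w : G := procyclic_of (add_subproof z w).
Definition procyclic_opp z : G := procyclic_of (opp_subproof z).

Lemma procyclic_addA : associative procyclic_add.
Proof. by move=> x y z; apply: procyclic_eq => n /=; rewrite modnDml modnDmr addnA. Qed.

Lemma procyclic_addC : commutative procyclic_add.
Proof. by move=> x y; apply: procyclic_eq => n /=; rewrite addnC. Qed.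

Lemma procyclic_add0 : left_id procyclic_zero procyclic_add.
Proof. by move=> x; apply: procyclic_eq => n /=; rewrite mod0n add0n residue_mod. Qed.

Lemma procyclic_addN : left_inverse procyclic_zero procyclic_opp procyclic_add.
Proof.
move=> x; apply: procyclic_eq => n /=; rewrite modnDml subnK ?modnn ?mod0n //.
by apply: ltnW; case: (residueP x n).
Qed.

HB.instance Definition _ := GRing.isZmodule.Build G
  procyclic_addA procyclic_addC procyclic_add0 procyclic_addN.

(** A residue determines the earlier ones, so that fixing the residue of index [n]
    gives a basic neighborhood of the topology of the inverse limit. *)
Definition procyclic_nbhs z : set_system G :=
  [set U | exists n, forall w, w n = z n -> U w].

HB.instance Definition _ := hasNbhs.Build G procyclic_nbhs.

Lemma procyclic_nbhs_filter z : ProperFilter (nbhs z).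
Proof.
apply: Build_ProperFilter_ex; last split.
- by move=> U [n nU]; exists z; exact: nU.
- by exists 0%N.
- move=> U V [m mU] [n nV]; exists (maxn m n) => w E; split.
    by apply: mU; apply: residue_le E; exact: leq_maxl.
  by apply: nV; apply: residue_le E; exact: leq_maxr.
- by move=> U V UV [n nU]; exists n => w /nU /UV.
Qed.

Lemma procyclic_nbhs_singleton z (U : set G) : nbhs z U -> U z.
Proof. by move=> [n nU]; exact: nU. Qed.

Lemma procyclic_nbhs_nbhs z (U : set G) : nbhs z U -> nbhs z (nbhs^~ U).
Proof.
by move=> [n nU]; exists n => w wz; exists n => w' w'w; apply: nU; rewrite w'w.
Qed.

HB.instance Definition _ := Nbhs_isNbhsTopological.Build G
  procyclic_nbhs_filter procyclic_nbhs_singleton procyclic_nbhs_nbhs.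

Lemma procyclic_sub_continuous : continuous (fun x : G * G => (x.1 - x.2)%R).
Proof.
move=> [x y] U [n nU].
exists ([set z : G | z n = x n], [set z : G | z n = y n]).
  by split; exists n.
by move=> [z w] /= [zx wy]; apply: nU => /=; rewrite zx wy.
Qed.

HB.instance Definition _ :=
  PreTopologicalNmodule_isTopologicalZmodule.Build G procyclic_sub_continuous.

Lemma procyclic_hausdorff : hausdorff_space G.
Proof.
move=> x y xy; apply: procyclic_eq => n.
have := xy [set z : G | z n = x n] [set z : G | z n = y n].
by case; [exists n|exists n|move=> z [/= <- <-]].
Qed.

End Procyclic.

(** * Sequences coded along a point *)

Definition code (A Z : finType) (h : nat) (L : fullshift A -> Z)
  (x : fullshift A) : fullshift Z := fun j => L (shift (h%:Z * j) x).

(** Then the code of [theta x] is the image under [zeta] of the code of [x]; see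
    [code_subst]. *)
Definition coding (l : nat) (A Z : finType) (theta : substitution l A)
    (h : nat) (X0 : set (fullshift A)) (zeta : substitution l Z)
    (L : fullshift A -> Z) : Prop :=
  forall x (m : 'I_l), X0 x ->
    L (shift (h%:Z * m%:Z) (subst_seq theta x)) = zeta m (L x).

Definition local (A : finType) (Z : Type) (X0 : set (fullshift A))
    (L : fullshift A -> Z) : Prop :=
  exists r : nat, forall x y, X0 x -> X0 y ->
    agree (- r%:Z) r%:Z x y -> L x = L y.

(** * The base of the height tower *)

Section Tower.
Variables (l : nat) (A : finType) (theta : substitution l A).
Variables (h : nat) (P : nat -> set (fullshift A)).
Hypothesis l_gt1 : (1 < l)%N.
Hypothesis h_gt0 : (0 < h)%N.
Hypothesis prim : primitive theta.
Hypothesis partP : height_partition theta h P.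
Implicit Types (x y : fullshift A) (i j : int).
Local Notation S := (subst_seq theta).
Local Notation X := (subshift theta).
Local Notation X0 := (P 0%N).

Let expl0 k : (0 < l ^ k)%N := expl_gt0 l_gt1 k.

Lemma base_sub x : X0 x -> X x.
Proof. by case: partP => <- _ _ _ _ X0x; exists 0%N. Qed.

Lemma level_shift k n x : P (k + n)%N (shift n%:Z x) <-> P k x.
Proof.
have [_ _ _ [Psh _] _] := partP.
elim: n => [|n IH]; first by rewrite addn0 shift0.
have En : n.+1%:Z = 1 + n%:Z by lia.
rewrite -IH addnS -Psh En -shiftD; split=> [[y Py /(can_inj (shiftK 1)) <-]|Py] //.
by exists (shift n x).
Qed.

Lemma level_modn k : P (k %% h)%N = P k.
Proof.
have [_ [_ Pper] _ _ _] := partP.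
rewrite {2}(divn_eq k h); elim: (k %/ h)%N => // n ->.
by rewrite mulSn -addnA [(h + _)%N]addnC Pper.
Qed.

Lemma level_inj k k' x : P k x -> P k' x -> k = k' %[mod h].
Proof.
have [_ [Ptriv _] _ _ _] := partP.
rewrite -(level_modn k) -(level_modn k') => Px Px'.
by apply: Ptriv; rewrite /= ?ltn_mod //; exists x.
Qed.

Lemma base_shift j x : X0 x -> X0 (shift (h%:Z * j) x).
Proof.
have shn (n : nat) y : X0 (shift (h * n)%N%:Z y) <-> X0 y.
  by have := level_shift 0 (h * n) y; rewrite -level_modn add0n modnMr.
case: j => n X0x; first by rewrite -PoszM; apply/shn.
apply/(shn n.+1); rewrite shiftD NegzE PoszM mulrN subrr shift0; exact: X0x.
Qed.

Lemma base_align j x : X0 x -> X0 (shift j x) -> exists i, j = h%:Z * i.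
Proof.
have aln (n : nat) y : X0 y -> X0 (shift n%:Z y) -> exists i, n%:Z = h%:Z * i.
  move=> /(level_shift 0 n) Py Py'; have := level_inj Py Py'.
  rewrite add0n mod0n => E; exists (n %/ h)%N%:Z.
  by rewrite {1}(divn_eq n h) E addn0 PoszM mulrC.
case: j => n X0x X0jx; first exact: aln X0x X0jx.
have [|i E] := aln n.+1 _ X0jx.
  by rewrite shiftD NegzE subrr shift0.
by exists (- i); rewrite NegzE E mulrN.
Qed.

Lemma base_subst k x : X0 x -> X0 (iter k S x).
Proof.
have [_ _ _ [_ PS] _] := partP.
by elim: k => // k IH /IH Px; apply: PS; exists (iter k S x).
Qed.

Lemma base_phase x : X x -> exists2 k : nat, (k < h)%N & X0 (shift (- k%:Z) x).
Proof.
have [<- _ _ _ _] := partP; case=> k _; rewrite -level_modn => Pk.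
exists (k %% h)%N; first by rewrite ltn_mod.
by apply/(level_shift 0 (k %% h)); rewrite add0n shiftD subrr shift0.
Qed.

Lemma base_cylinder x y : X0 x -> X y -> agree 0 h%:Z x y -> X0 y.
Proof.
have [_ _ _ _ P0E] := partP => X0x Xy xy; rewrite P0E; split=> //.
exists x => //; apply: eq_from_tnth => i; rewrite !tnth_mktuple xy //.
by rewrite lez_nat ltz_nat ltn_ord.
Qed.

Lemma base_closed : closed X0.
Proof.
apply/closed_fullshiftP => x xX.
have Xx : X x.
  apply: (closed_agree (@subshift_closed _ _ theta l_gt1)) => N.
  by have [y /base_sub Xy xy] := xX N; exists y.
have [y X0y xy] := xX h; apply: base_cylinder X0y Xx _.
by apply: agree_sym; apply: agreeW xy; lia.
Qed.

(** By primitivity a window of [x] occurs in [S^k y] for all large [k]. The window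
    determines membership in the base, so it occurs at a multiple of [h]; the
    window is taken longer than [N] to keep [j] away from [0] and [l^k]. *)
Lemma base_recurrence x (N : nat) : X0 x -> exists k0 : nat,
  forall k, (k0 <= k)%N -> forall y, X0 y ->
  exists j : nat, [/\ (N <= j)%N, (j + N < l ^ k)%N
    & agree (- N%:Z) N%:Z x (shift (h%:Z * j%:Z) (iter k S y))].
Proof.
move=> X0x; pose M := (h * N.+1)%N.
have [k0 k0P] := primitive_word l_gt1 prim
  (subshift_word (- M%:Z) (M + M) (base_sub X0x)).
exists k0 => k /k0P kP y X0y; have [i] := kP y; rewrite size_word => iM E.
have xy : agree (- M%:Z) M%:Z x (shift (i + M)%N%:Z (iter k S y)).
  have := word_agree E.
  have -> : - M%:Z + (M + M)%N%:Z = M%:Z by lia.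
  by have -> : i%:Z - - M%:Z = (i + M)%N%:Z by lia.
have X0y' : X0 (shift (i + M)%N%:Z (iter k S y)).
  apply: (base_cylinder X0x).
    exact/subshift_shift/base_sub/base_subst.
  by apply: agreeW xy; rewrite /M; nia.
have [j jE] := base_align (base_subst k X0y) X0y'.
have j0 : 0 <= j by nia.
move: jE xy; case: j j0 => // j _ jE; rewrite jE => xy; exists j; split.
- by rewrite /M in jE; nia.
- by rewrite /M in jE iM *; nia.
- by apply: agreeW xy; rewrite /M; nia.
Qed.

(** By [base_recurrence] the union of the sets [T^j S^n X0], [j < l^n], is dense in
    the base; by compactness it is closed. *)
Lemma base_desubst n x : X0 x -> exists (j : nat) y,
  [/\ (j < l ^ n)%N, X0 y & x = shift (h%:Z * j%:Z) (iter n S y)].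
Proof.
move=> X0x.
have : forall N : nat, exists (jy : nat * fullshift A),
  [/\ (jy.1 < l ^ n)%N, X0 jy.2
    & agree (- N%:Z) N%:Z x (shift (h%:Z * jy.1%:Z) (iter n S jy.2))].
  move=> N; have [k0 k0P] := base_recurrence N X0x.
  have [j [_ _ E]] := k0P (n + k0)%N (leq_addl _ _) _ X0x.
  exists (j %% l ^ n, shift (h%:Z * (j %/ l ^ n)%N%:Z) (iter k0 S x))%N => /=.
  split; first by rewrite ltn_mod.
    exact/base_shift/base_subst.
  rewrite iter_subst_shift // shiftD -iterD.
  suff <- : h%:Z * j%:Z = h%:Z * (j %% l ^ n)%N%:Z
      + (l ^ n)%N%:Z * (h%:Z * (j %/ l ^ n)%N%:Z) by [].
  by rewrite {1}(divn_eq j (l ^ n)) PoszD PoszM; ring.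
move=> /choice[u uP].
have [y yP] := cluster_seq (fun N => (u N).2).
(* By the pigeonhole principle some [j] occurs along a subsequence. *)
have : exists2 j : nat, (j < l ^ n)%N & forall N : nat, exists2 M, (N <= M)%N &
    (u M).1 = j /\ agree (- N%:Z) N%:Z y (u M).2.
  apply: contrapT => H.
  have : forall j : nat, exists N : nat, (j < l ^ n)%N -> forall M, (N <= M)%N ->
      (u M).1 = j -> ~ agree (- N%:Z) N%:Z y (u M).2.
    move=> j; apply: contrapT => H'; apply: H; exists j.
      by apply/negPn/negP => jl; apply: H'; exists 0%N => /(negP jl).
    move=> N; apply: contrapT => H''; apply: H'; exists N => _ M NM uj yu.
    by apply: H''; exists M.
  move=> /choice[f fP]; pose N := (\max_(j < l ^ n) f j)%N.
  have [M NM yu] := yP N N; have [uM _ _] := uP M.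
  have fN : (f (u M).1 <= N)%N.
    exact: (@leq_bigmax _ (fun j : 'I_(l ^ n) => f j) (Ordinal uM)).
  apply: (fP (u M).1 uM M _ erefl); first exact: leq_trans fN NM.
  by apply: agreeW yu; lia.
case=> j jl jP; exists j, y; split=> //.
  apply: closed_agree base_closed _ => N; have [M _ [_ yu]] := jP N.
  by exists (u M).2 => //; case: (uP M).
apply/funext => i; pose N := (`|i| + h * j).+1%N.
have [M NM [uj yu]] := jP N; have [_ _ xu] := uP M.
rewrite (xu i); last by lia.
rewrite uj /shift; have := expl0 n.
move: (iter_subst_agree theta l_gt1 (n := n) yu) => E e0.
by rewrite E //; rewrite /N; nia.
Qed.

Lemma base_minimal x y (N : nat) : X0 x -> X0 y ->
  exists j, agree (- N%:Z) N%:Z x (shift (h%:Z * j) y).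
Proof.
move=> X0x X0y; have [k kP] := base_recurrence N X0x.
have [i [z [_ X0z ->]]] := base_desubst k X0y.
have [j [_ _ E]] := kP k (leqnn _) z X0z.
exists (j%:Z - i%:Z); rewrite shiftD.
by have -> : h%:Z * (j%:Z - i%:Z) + h%:Z * i%:Z = h%:Z * j%:Z by ring.
Qed.

Lemma subshift_minimal x y (N : nat) : X x -> X y ->
  exists j, agree (- N%:Z) N%:Z x (shift j y).
Proof.
move=> /base_phase[k kh X0x] /base_phase[k' kh' X0y].
have [j E] := base_minimal (N + h) X0x X0y.
exists (k%:Z + h%:Z * j - k'%:Z).
rewrite -[x](shiftNK k%:Z) -addrA -!shiftD.
apply: agree_shift; apply: agreeW E; lia.
Qed.

(** * Codings of the base *)

Local Notation coding := (coding theta h X0).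

Lemma code_shift (Z : finType) (L : fullshift A -> Z) j x :
  code h L (shift (h%:Z * j) x) = shift j (code h L x).
Proof. by apply/funext => i; rewrite [RHS]/shift /code shiftD -mulrDr. Qed.

Lemma code0 (Z : finType) (L : fullshift A -> Z) x : code h L x 0 = L x.
Proof. by rewrite /code mulr0 shift0. Qed.

Lemma local_code (Z : finType) (L : fullshift A -> Z) (N : nat) : local X0 L ->
  exists r : nat, forall x y, X0 x -> X0 y -> agree (- r%:Z) r%:Z x y ->
    agree (- N%:Z) N%:Z (code h L x) (code h L y).
Proof.
move=> [r rP]; exists (r + h * N)%N => x y X0x X0y xy i iN.
apply: rP; [exact: base_shift|exact: base_shift|].
by apply: agree_shift; apply: agreeW xy; nia.
Qed.

Section OneCoding.
Variables (Z : finType) (zeta : substitution l Z) (L : fullshift A -> Z).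
Hypothesis cL : coding zeta L.

Lemma code_subst x : X0 x -> code h L (S x) = subst_seq zeta (code h L x).
Proof.
move=> X0x; apply: (subst_seqP l_gt1) => i m.
rewrite /code -cL; last exact: base_shift.
rewrite subst_shift // shiftD; congr (L _); apply: eq_shift; ring.
Qed.

Lemma code_iter k x :
  X0 x -> code h L (iter k S x) = iter k (subst_seq zeta) (code h L x).
Proof.
move=> X0x; elim: k => // k IH; rewrite !iterS -IH code_subst //.
exact: base_subst.
Qed.

Lemma coding_word k x : X0 x ->
  iter k (subst_word zeta) [:: L x] = word (code h L (iter k S x)) 0 (l ^ k).
Proof. by move=> X0x; rewrite -code0 iter_subst_letter // code_iter. Qed.

Lemma coding_language w : (forall a, exists2 x, X0 x & L x = a) ->
  allowed zeta w ->
  exists2 x, X0 x & w = word (code h L x) 0 (size w).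
Proof.
move=> sL [k [a wa]]; have [x X0x Lx] := sL a.
move: wa; rewrite -Lx coding_word // => /infix_wordP[j _ ->].
rewrite size_word add0r.
exists (shift (h%:Z * j%:Z) (iter k S x)).
  exact/base_shift/base_subst.
by rewrite code_shift; apply: word_eqP => i _; rewrite /shift add0r addrC.
Qed.

(** Any window of [x] occurs in some [S^k x] at a place that lies within the
    [k]-th image of the first letter of the code of [x]. *)
Lemma coding_subshift x : local X0 L -> X0 x -> subshift zeta (code h L x).
Proof.
move=> lL X0x; apply/(subshiftP _ l_gt1) => N.
have [r rP] := local_code N lL.
have [k kP] := base_recurrence (maxn r N) X0x.
have [j [Nj jl E]] := kP k (leqnn _) x X0x.
exists k, (L x); rewrite coding_word //.
have -> : word (code h L x) (- N%:Z) (N + N)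
    = word (code h L (iter k S x)) (j%:Z - N%:Z) (N + N).
  apply: agree_word; have -> : - N%:Z + (N + N)%N%:Z = N%:Z by lia.
  have -> : j%:Z - N%:Z - - N%:Z = j%:Z by lia.
  rewrite -code_shift; apply: rP => //.
    exact/base_shift/base_subst.
  by apply: agreeW E; lia.
by apply: infix_word; lia.
Qed.

(** The columns of the powers of [zeta] and the elements of the semigroup are the
    same maps; this lemma and the next use this to see the semigroup through [X0]. *)
Lemma coding_column (k j : nat) : (0 < k)%N -> (j < l ^ k)%N ->
  exists2 g, column_semigroup zeta g
    & forall x, X0 x -> L (shift (h%:Z * j%:Z) (iter k S x)) = g (L x).
Proof.
case: k => // k _; elim: k j => [|k IH] j jl.
  rewrite expn1 in jl; exists (zeta (Ordinal jl)); first by constructor.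
  by move=> x X0x; rewrite -cL.
have l0 : (0 < l)%N by lia.
have mlt : (j %% l < l)%N by rewrite ltn_mod.
have [|g Sg gP] := IH (j %/ l)%N; first by rewrite ltn_divLR // -expnSr.
exists (zeta (Ordinal mlt) \o g); first by constructor=> //; constructor.
move=> x X0x /=; rewrite -gP // -cL; last first.
  exact/base_shift/base_subst.
rewrite subst_shift // shiftD; congr (L _); apply: eq_shift.
by rewrite {1}(divn_eq j l) PoszD PoszM /=; ring.
Qed.

Lemma column_coding g : column_semigroup zeta g -> exists k j : nat,
  [/\ (0 < k)%N, (j < l ^ k)%N
    & forall x, X0 x -> L (shift (h%:Z * j%:Z) (iter k S x)) = g (L x)].
Proof.
elim=> [m|f1 f2 _ [k1 [j1 [k10 jl1 E1]]] _ [k2 [j2 [k20 jl2 E2]]]].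
  by exists 1%N, m; split=> // x X0x; exact: cL.
exists (k1 + k2)%N, (j1 + l ^ k1 * j2)%N; split.
- by rewrite addn_gt0 k10.
- by rewrite expnD; nia.
move=> x X0x /=; rewrite -E2 // -E1; last first.
  exact/base_shift/base_subst.
rewrite iter_subst_shift // shiftD -iterD; congr (L _); apply: eq_shift.
by rewrite PoszD PoszM; ring.
Qed.

End OneCoding.

Lemma pure_base_coding : X0 !=set0 ->
  exists L : fullshift A -> pure_base_alphabet h P,
  [/\ coding (pure_base partP) L, forall a, exists2 x, X0 x & L x = a
    & forall x y, X0 x -> X0 y -> (L x = L y <-> agree 0 h%:Z x y)].
Proof.
move=> [x0 X0x0].
have a0P x : X0 x -> `[< (@init_word A h @` X0) (init_word h x) >].
  by move=> X0x; apply/asboolP; exists x.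
pose a0 : {w : h.-tuple A | `[< (@init_word A h @` X0) w >]} :=
  exist _ (init_word h x0) (a0P _ X0x0).
pose L x : pure_base_alphabet h P := insubd a0 (init_word h x).
have LE x : X0 x -> val (L x) = init_word h x.
  by move=> X0x; rewrite /L val_insubd a0P.
exists L; split.
- move=> x m X0x; apply: val_inj; rewrite /= LE; last first.
    exact/base_shift/(base_subst 1).
  rewrite LE // init_word_block; last by rewrite addnC -mulSn leq_mul2r ltn_ord orbT.
  by rewrite iter_left_shift PoszM mulrC.
- case=> w wP; have /asboolP[x X0x xw] := wP.
  by exists x => //; apply: val_inj; rewrite LE.
move=> x y X0x X0y; split=> [/(congr1 val)|E].
  rewrite !LE // => E i ilt.
  have ih : (absz i < h)%N by lia.
  have := congr1 (fun w => tnth w (Ordinal ih)) E; rewrite !tnth_mktuple /=.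
  by have -> : (absz i)%:Z = i by lia.
apply: val_inj; rewrite !LE //; apply: eq_from_tnth => i; rewrite !tnth_mktuple.
by rewrite E //; have := ltn_ord i; lia.
Qed.

(** The windows of the codes around the origin are exactly the allowed words, by
    [coding_subshift] and [coding_language]. *)
Lemma collar_coding (Z : finType) (zeta : substitution l Z)
    (L : fullshift A -> Z) (a b : nat) : X0 !=set0 ->
  coding zeta L -> (forall a, exists2 x, X0 x & L x = a) -> local X0 L ->
  exists M : fullshift A -> collar_alphabet zeta a b,
  [/\ coding (collar zeta a b) M, forall c, exists2 x, X0 x & M x = c
    & forall x y, X0 x -> X0 y -> (M x = M y <->
        agree (- a%:Z) b.+1%:Z (code h L x) (code h L y))].
Proof.
move=> [x0 X0x0] cL sL lL; pose n := (a + b).+1.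
have ws x : size (word (code h L x) (- a%:Z) n) == n by rewrite size_word.
pose W x : n.-tuple Z := Tuple (ws x).
have WP x : X0 x -> `[< allowed zeta (W x) >].
  by move=> X0x; apply/asboolP; exact: (coding_subshift cL lL X0x).
pose c0 : {w : n.-tuple Z | `[< allowed zeta w >]} := exist _ (W x0) (WP _ X0x0).
pose M x : collar_alphabet zeta a b := insubd c0 (W x).
have ME x : X0 x -> val (M x) = W x by move=> X0x; rewrite /M val_insubd WP.
exists M; split.
- move=> x m X0x; apply: val_inj; rewrite /= ME; last first.
    exact/base_shift/(base_subst 1).
  rewrite ME //; apply: val_inj => /=; rewrite blockE; last first.
    by have := ltn_ord m; move: (nat_of_ord m) => k klt; rewrite /n; nia.
  rewrite subst_word_word // -code_subst // code_shift.
  have ml := ltn_ord m; move: (nat_of_ord m) ml => k ml.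
  pose d := (l * a + k - a)%N; pose e := (l * n - d - n)%N.
  have dE : (d + a = l * a + k)%N by rewrite /d; nia.
  have -> : (l * n = d + (n + e))%N by rewrite /e /d /n; nia.
  (* The block starts at offset [d] in the image of the collared letter, which
     begins at place [- l a]; this is place [k - a]. *)
  rewrite -/d !word_cat drop_size_cat ?size_word // take_size_cat ?size_word //.
  apply: word_eqP => i _; rewrite /shift; congr (code h L _ _); nia.
- case=> w wP; have /asboolP aw := wP.
  have [x X0x wx] := coding_language cL sL aw.
  exists (shift (h%:Z * a%:Z) x); first exact: base_shift.
  apply: val_inj; rewrite ME; last exact: base_shift.
  apply: val_inj; rewrite /= {}wx size_tuple code_shift.
  by apply: word_eqP => i _; rewrite /shift; congr (code h L _ _); lia.
move=> x y X0x X0y; have nE : - a%:Z + n%:Z = b.+1%:Z by rewrite /n; lia.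
split=> [/(congr1 val)|E].
  rewrite !ME // => /(congr1 val) /= /word_agree.
  by rewrite nE subrr shift0.
by apply: val_inj; rewrite !ME //; apply: val_inj; apply: agree_word;
  rewrite nE subrr shift0.
Qed.

(** Three consecutive letters of the pure base spell out a window of length [3 h]. *)
Lemma collared_base_coding : X0 !=set0 ->
  exists L : fullshift A -> collar_alphabet (pure_base partP) 1 1,
  [/\ coding (collar (pure_base partP) 1 1) L,
      forall a, exists2 x, X0 x & L x = a
    & forall x y, X0 x -> X0 y ->
        (L x = L y <-> agree (- h%:Z) (2 * h%:Z) x y)].
Proof.
move=> X0n; have [L [cL sL LE]] := pure_base_coding X0n.
have lL : local X0 L.
  exists h => x y X0x X0y xy; apply/LE => //; apply: agreeW xy; lia.
have [M [cM sM ME]] := collar_coding 1 1 X0n cL sL lL.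
exists M; split=> // x y X0x X0y; rewrite ME //; split=> E i ilt.
  pose j := (i %/ h%:Z)%Z.
  have jlt : - 1%:Z <= j < 2%:Z by rewrite /j lez_divRL ?ltz_divLR; lia.
  have /LE := E j jlt => /(_ (base_shift _ X0x) (base_shift _ X0y)).
  move=> /(_ (i %% h%:Z)%Z); rewrite /shift addrC mulrC -divz_eq; apply.
  by rewrite modz_ge0 ?ltz_pmod; lia.
apply/LE; [exact: base_shift|exact: base_shift|].
by apply: agree_shift; apply: agreeW E; nia.
Qed.

(** * Codings by the inner encoding *)

Section Inner.
Variables (Z : finType) (zeta : substitution l Z) (L : fullshift A -> Z).
Hypothesis X0_nonempty : X0 !=set0.
Hypothesis cL : coding zeta L.
Hypothesis sL : forall a, exists2 x, X0 x & L x = a.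
Hypothesis lL : local X0 L.

Let l_gt0 : (0 < l)%N := ltnW l_gt1.

(** By recurrence every letter is read in the image, under a power of the
    substitution, of a point whose letter lies in a kernel image [im f]; it then
    lies in the image of a product with [f] on the right. *)
Lemma kernel_images_cover a : exists2 C, C \in kernel_images zeta & a \in C.
Proof.
have [f kf _] := kernel_images_nonempty zeta l_gt0.
have [Sf _] := (kernelP zeta l_gt0 f).1 kf.
have [k [j [k0 jl fE]]] := column_coding cL Sf.
have [x X0x <-] := sL a; have [r rP] := lL.
have [k1 kP] := base_recurrence r X0x.
pose y := shift (h%:Z * j%:Z) (iter k S x).
have X0y : X0 y by exact/base_shift/base_subst.
have [j1 [_ jl1 E]] := kP k1.+1 (leqnSn _) y X0y.
have [|g Sg gE] := coding_column cL (k := k1.+1) (j := j1) isT.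
  exact: leq_ltn_trans (leq_addr _ _) jl1.
exists ((g \o f) @: [set: Z])%SET.
  apply/kernel_imagesP; exists (g \o f) => //.
  exact: kernel_comp_l.
apply/imsetP; exists (L x) => //=; rewrite -fE // -gE //.
by apply: rP => //; exact/base_shift/base_subst.
Qed.

(** The class of the letter is a coding because the column maps send classes into
    classes. *)
Lemma inner_coding : exists M : fullshift A -> inner_alphabet zeta,
  [/\ coding (inner_encoding zeta) M, forall a, exists2 x, X0 x & M x = a
    & forall x, L x \in val (M x)].
Proof.
have : forall x, exists M : inner_alphabet zeta, L x \in val M.
  move=> x; have [C KC LC] := kernel_images_cover (L x).
  have [D PD CD] := kernel_image_class KC.
  by exists (exist _ D PD); exact: (fintype.subsetP CD).
move=> /choice[M MP]; exists M; split=> // [x m X0x|a].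
  apply: val_inj.
  apply: (coincidence_class_uniq (valP _) (valP _) (MP _)).
  rewrite cL //; apply: (fintype.subsetP (inner_encodingP m (M x))).
  exact: imset_f.
have [x0 _] := X0_nonempty.
have [c ca] := coincidence_class_nonempty (L x0) (valP a).
have [x X0x Lx] := sL c; exists x => //; apply: val_inj.
by apply: (coincidence_class_uniq (valP _) (valP _) (MP x)); rewrite Lx.
Qed.

End Inner.

(** * The odometer factor *)

Variable p : fullshift A -> {ptws nat -> nat}.
Hypothesis pF : factor_map X (@left_shift A) (odometer l h) (odometer_succ l h) p.

Lemma odometer_range x : X x -> odometer l h (p x).
Proof. by case: pF => _ <- _ Xx; exists x. Qed.

Lemma odometer_lt x n : X x -> (p x n < l ^ n * h)%N.
Proof. by move=> /odometer_range /(_ n)[]. Qed.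

Lemma odometer_mod x n k : X x -> p x n = (p x (n + k) %% (l ^ n * h))%N.
Proof.
move=> Xx; elim: k => [|k IH].
  by rewrite addn0 modn_small // odometer_lt.
have [_] := odometer_range Xx (n + k)%N; rewrite addnS IH => <-.
apply: modn_dvdm; rewrite expnD mulnAC; exact: dvdn_mulr.
Qed.

Lemma odometer_shift j x n : X x -> exists q : int,
  (p (shift j x) n)%:Z = (p x n)%:Z + j + q * (l ^ n * h)%N%:Z.
Proof.
have pS y : X y -> exists q : int,
    (p (shift 1 y) n)%:Z = (p y n)%:Z + 1 + q * (l ^ n * h)%N%:Z.
  move=> Xy; have [_ _ /(_ y Xy) ->] := pF.
  exists (- ((p y n).+1 %/ (l ^ n * h))%N%:Z); rewrite /odometer_succ.
  have := divn_eq (p y n).+1 (l ^ n * h); lia.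
have pn (k : nat) y : X y -> exists q : int,
    (p (shift k%:Z y) n)%:Z = (p y n)%:Z + k%:Z + q * (l ^ n * h)%N%:Z.
  elim: k y => [|k IH] y Xy; first by exists 0; rewrite shift0; lia.
  have [q E] := pS y Xy.
  have [q' E'] := IH (shift 1 y) (subshift_shift 1 Xy).
  exists (q + q'); move: E'; rewrite shiftD (_ : k%:Z + 1 = k.+1%:Z); last lia.
  by move=> ->; rewrite E; lia.
case: j => k Xx; first exact: pn.
have [q E] := pn k.+1 (shift (Negz k) x) (subshift_shift (Negz k) Xx).
exists (- q); move: E; rewrite shiftD (_ : k.+1%:Z + Negz k = 0); last lia.
by rewrite shift0 => ->; lia.
Qed.

Lemma odometer_local x n : X x -> exists N : nat,
  forall y, X y -> agree (- N%:Z) N%:Z x y -> p y n = p x n.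
Proof. by move=> Xx; case: pF => pc _ _; exact: within_coord pc Xx. Qed.

Lemma odometer_shift_mul i x n : X x -> p (shift ((l ^ n * h)%N%:Z * i) x) n = p x n.
Proof.
move=> Xx; have [q E] := odometer_shift ((l ^ n * h)%N%:Z * i) n Xx.
have lt1 := odometer_lt n Xx.
have lt2 := odometer_lt n (subshift_shift ((l ^ n * h)%N%:Z * i) Xx).
move: (p _ n) (p _ n) E lt1 lt2 => a b; move: (l ^ n * h)%N => N E lt1 lt2.
have {}E : b%:Z - a%:Z = (i + q) * N%:Z by rewrite mulrDl; lia.
have [t0|t0|t0] := ltgtP (i + q) 0; [nia|nia|].
by move: E; rewrite t0; lia.
Qed.

Lemma odometer_shift_eq j x y n : X x -> X y ->
  p x n = p y n -> p (shift j x) n = p (shift j y) n.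
Proof.
move=> Xx Xy E; have [q Eq] := odometer_shift j n Xx.
have [q' Eq'] := odometer_shift j n Xy.
have lt1 := odometer_lt n (subshift_shift j Xx).
have lt2 := odometer_lt n (subshift_shift j Xy).
rewrite E in Eq; move: (p (shift j x) n) (p (shift j y) n) Eq Eq' lt1 lt2 => a b.
move: (l ^ n * h)%N => N Eq Eq' lt1 lt2.
have {Eq Eq'}E' : a%:Z - b%:Z = (q - q') * N%:Z by rewrite Eq Eq'; ring.
have [t0|t0|t0] := ltgtP (q - q') 0; [nia|nia|].
by move: E'; rewrite t0; lia.
Qed.

(** The map [p n \o S^n] is continuous, and invariant under the minimal map
    [shift h] of the base because [S^n] turns a shift by [h] into a shift by
    [l^n h]. *)
Lemma odometer_subst x y n : X0 x -> X0 y -> p (iter n S x) n = p (iter n S y) n.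
Proof.
move=> X0x X0y; have Xx := base_sub (base_subst n X0x).
have [N NP] := odometer_local n Xx.
have [j E] := base_minimal N X0x X0y.
have e0 := expl_gt0 l_gt1 n.
have X0jy : X0 (shift (h%:Z * j) y) by exact: base_shift.
rewrite -(NP (iter n S (shift (h%:Z * j) y))).
- rewrite iter_subst_shift // mulrA -PoszM odometer_shift_mul //.
  exact/base_sub/base_subst.
- exact/base_sub/base_subst.
by apply: agreeW (iter_subst_agree theta l_gt1 (n := n) E); nia.
Qed.

Lemma odometer_base x y : X x -> X0 y -> p x 0%N = p y 0%N -> X0 x.
Proof.
move=> Xx X0y xy; have [k kh X0k] := base_phase Xx.
have [q] := odometer_shift (- k%:Z) 0 Xx.
rewrite (@odometer_subst _ _ 0 X0k X0y) /= xy expn0 mul1n.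
case: k kh X0k => [|k] kh X0k; first by rewrite -(shift0 x).
move=> E; exfalso; have {}E : q * h%:Z = k.+1%:Z by lia.
by have [q0|q0] : (q <= 0 \/ 1 <= q)%R; [lia|nia|nia].
Qed.

(** The translates of [S^n X0] by [T^j], [j < l^n], are told apart by the
    coordinate of [p] modulo [l^n h], which is a constant plus [h j]. *)
Lemma odometer_desubst x y n (j : nat) : X0 x -> X0 y -> (j < l ^ n)%N ->
  p x n = p (shift (h%:Z * j%:Z) (iter n S y)) n ->
  exists2 z, X0 z & x = shift (h%:Z * j%:Z) (iter n S z).
Proof.
move=> X0x X0y jl E; have [j' [z [jl' X0z Ex]]] := base_desubst n X0x.
exists z => //; suff -> : j = j' by [].
move: E; rewrite Ex.
have [q E1] := odometer_shift (h%:Z * j%:Z) n (base_sub (base_subst n X0y)).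
have [q' E2] := odometer_shift (h%:Z * j'%:Z) n (base_sub (base_subst n X0z)).
rewrite (odometer_subst n X0z X0y) in E2.
move=> /(congr1 Posz); rewrite E1 E2 PoszM => E; clear E1 E2 Ex X0y X0z X0x X0z.
move: (l ^ n)%N jl jl' E => N jl jl' E.
have {}E : h%:Z * (j'%:Z - j%:Z - (q - q') * N%:Z) = 0.
  by rewrite !(mulrBr, mulrBl) mulrA [h%:Z * q]mulrC; lia.
move/eqP: E; rewrite mulf_eq0 => /orP[|/eqP E]; first by lia.
have [t0|t0|t0] := ltgtP (q - q') 0; [nia|nia|lia].
Qed.

(** * Almost automorphic factors make the inner encoding aperiodic *)

Section Factor.
Variables (B : finType) (Y : set (fullshift B)).
Variable q : fullshift A -> fullshift B.
Hypothesis Yshift : is_shift Y.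
Hypothesis qF : factor_map X (@left_shift A) Y (@left_shift B) q.

Lemma factor_shift j x : X x -> q (shift j x) = shift j (q x).
Proof.
have qn (k : nat) y : X y -> q (shift k%:Z y) = shift k%:Z (q y).
  elim: k y => [|k IH] y Xy; first by rewrite !shift0.
  have -> : k.+1%:Z = k%:Z + 1 by lia.
  rewrite -!shiftD IH; last exact: (subshift_shift 1).
  by have [_ _ /(_ y Xy) E] := qF; rewrite -[shift 1 y]/(left_shift y) E.
case: j => k Xx; first exact: qn.
apply: (can_inj (shiftK k.+1%:Z)); rewrite -qn; last exact: subshift_shift.
by rewrite !shiftD (_ : k.+1%:Z + Negz k = 0) ?shift0 //; lia.
Qed.

Lemma factor_local x (N : nat) : X x -> exists M : nat, forall y, X y ->
  agree (- M%:Z) M%:Z x y -> agree (- N%:Z) N%:Z (q x) (q y).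
Proof.
move=> Xx; have [qc _ _] := qF.
exact: (within_agree qc Xx (nbhs_agree (q x) N)).
Qed.

(** The point of the group with a single preimage gives a fiber of the maximal
    equicontinuous factor on which [q] is constant, because that factor maps
    onto the group. *)
Lemma constant_fiber : is_max_equicontinuous_factor X (@left_shift A)
    (odometer l h) (odometer_succ l h) p ->
  almost_automorphic Y (@left_shift B) ->
  exists2 x0, X0 x0 & forall x, X x -> (forall n, p x n = p x0 n) -> q x = q x0.
Proof.
move=> [_ _ pmax] [G [g [r [cG hG [rc rY rg] [g0 _ [y1 [[Yy1 ry1] y1u]]]]]]].
have [qc qX qs] := qF.
have rqF : factor_map X (@left_shift A) [set: group_uniform G]
    (fun z : G => z + g) (r \o q : fullshift A -> group_uniform G).
  split; last by move=> x Xx /=; rewrite qs // rg // -qX; exists x.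
    apply: within_agreeP => x U Xx rqU.
    have Yqx : Y (q x) by rewrite -qX; exists x.
    have [N NU] := within_agree rc Yqx rqU.
    have [M MP] := factor_local N Xx.
    exists M => y Xy xy; apply: NU; first by rewrite -qX; exists y.
    exact: MP.
  by rewrite -image_comp qX.
have [s _ sE] := pmax _ _ _ _ (rotation_equicontinuous g cG hG) rqF.
have : Y y1 by []; rewrite -qX => -[x1 Xx1 qx1].
have [k _ X0x0] := base_phase Xx1.
exists (shift (- k%:Z) x1) => // x Xx px.
rewrite factor_shift //.
apply: (can_inj (shiftK k%:Z)); rewrite -factor_shift // shiftNK qx1.
have Xkx : X (shift k%:Z x) by exact: subshift_shift.
apply/esym/y1u; split; first by rewrite -qX; exists (shift k%:Z x).
have /= -> := sE _ Xkx; rewrite -ry1 -qx1; have /= -> := sE _ Xx1.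
congr (s _); apply/funext => n.
rewrite (odometer_shift_eq k%:Z Xx _ (px n)); last exact: subshift_shift.
by rewrite shiftNK.
Qed.

Section Necessity.
Variable x0 : fullshift A.
Hypothesis X0x0 : X0 x0.
Hypothesis x0_fiber : forall x, X x -> (forall n, p x n = p x0 n) -> q x = q x0.

(** Otherwise there would be points that share more and more digits with [x0] in
    the odometer and whose images differ from that of [x0] near the origin; they
    would accumulate at a point of the fiber of [x0] with a different image. *)
Lemma constant_window (R N : nat) : exists (m z : nat),
  [/\ (N <= m)%N, (z < l ^ m)%N
    & forall x, X0 x -> agree (- R%:Z) R%:Z (q x0)
        (q (shift (h%:Z * z%:Z) (iter m S x)))].
Proof.
apply: contrapT => H.
have : forall m : nat, exists w, X w /\ (forall n, (n <= m)%N -> p w n = p x0 n)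
    /\ ((N <= m)%N -> ~ agree (- R%:Z) R%:Z (q x0) (q w)).
  move=> m; have [z [x [zl X0x E]]] := base_desubst m X0x0.
  case: (leqP N m) => [Nm|mN]; last first.
    by exists x0; split; [exact: base_sub|split].
  apply: contrapT => H'; apply: H; exists m, z; split=> // y X0y.
  apply: contrapT => H''; apply: H'.
  have Xw : X (shift (h%:Z * z%:Z) (iter m S y)).
    exact/base_sub/base_shift/base_subst.
  exists (shift (h%:Z * z%:Z) (iter m S y)); split=> //; split=> // n nm.
  rewrite -(subnKC nm) in E Xw *.
  rewrite (odometer_mod n (m - n) Xw) (odometer_mod n (m - n) (base_sub X0x0)).
  rewrite E; congr (_ %% _)%N.
  apply: odometer_shift_eq.
  - exact/base_sub/base_subst.
  - exact/base_sub/base_subst.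
  - exact: odometer_subst.
move=> /choice[u uP].
have [w wP] := cluster_seq u.
have Xw : X w.
  apply: (closed_agree (@subshift_closed _ _ theta l_gt1)) => M.
  by have [n _ E] := wP M 0%N; exists (u n) => //; case: (uP n).
have qw : q w = q x0.
  apply: x0_fiber => // n; have [M MP] := odometer_local n Xw.
  have [m nm E] := wP M n; have [Xu [up _]] := uP m.
  by rewrite -up // MP.
have [M MP] := factor_local R Xw.
have [m Nm E] := wP M N; have [Xu [_ /(_ Nm)]] := uP m; apply.
by rewrite -qw; apply: MP.
Qed.

Variables (Z : finType) (zeta : substitution l Z) (L : fullshift A -> Z).
Hypothesis cL : coding zeta L.
Hypothesis sL : forall a, exists2 x, X0 x & L x = a.
Hypothesis LE : forall x y, X0 x -> X0 y ->
  (L x = L y <-> agree (- h%:Z) (2 * h%:Z) x y).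

Let l_gt0 : (0 < l)%N := ltnW l_gt1.

(** The letter [L x] gives the window [-h, 2 h) of [x], hence the window
    [-l^n h, 2 l^n h) of [S^n x]. If [l^n h] exceeds the radius of the block code
    [q], this suffices to compute [q (S^n x)] on the middle third. *)
Lemma block_code : exists n : nat, forall x y (s : nat), X0 x -> X0 y ->
  L x = L y -> (s < l ^ n * h)%N -> q (iter n S x) s%:Z = q (iter n S y) s%:Z.
Proof.
have [qc _ _] := qF.
have [r rP] := sliding_block (@subshift_closed _ _ theta l_gt1) qc.
exists r => x y s X0x X0y /(LE X0x X0y) xy sl.
have rl := expl_gt l_gt1 r.
have Xx := base_sub (base_subst r X0x); have Xy := base_sub (base_subst r X0y).
have qs z : X z -> q z s%:Z = q (shift s%:Z z) 0.
  by move=> Xz; rewrite factor_shift // /shift add0r.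
rewrite !qs //; apply: rP; [exact: subshift_shift|exact: subshift_shift|].
apply: agree_shift.
by apply: agreeW (iter_subst_agree theta l_gt1 (n := r) xy); nia.
Qed.

Section Block.
Variable n : nat.
Hypothesis nP : forall x y (s : nat), X0 x -> X0 y ->
  L x = L y -> (s < l ^ n * h)%N -> q (iter n S x) s%:Z = q (iter n S y) s%:Z.

(** If [f] lies in the kernel, [im f] is the set of letters that are read at a
    suitable place near the origin by the points [T^z S^m x], [x] in the base;
    these have the same image under [q] there. *)
Lemma block_kernel_image C : C \in kernel_images zeta ->
  forall x y (s : nat), X0 x -> X0 y -> L x \in C -> L y \in C ->
  (s < l ^ n * h)%N -> q (iter n S x) s%:Z = q (iter n S y) s%:Z.
Proof.
move=> /kernel_imagesP[f kf ->] x y s X0x X0y Lx Ly sl.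
have fmin := (kernelP zeta l_gt0 f).1 kf; have [Sf _] := fmin.
have [M [k [M0 kl fE]]] := column_coding cL Sf.
(* The places below differ from the origin by at most [h l^n (l^M + 2)]. *)
pose R := (h * (l ^ n * (l ^ M + 3)))%N.
have [m [z [Nm zl zP]]] := constant_window R (n + M + 1).
(* The digits of [z] are split so that [T^z S^m] is
   [T^z1 S^n T^z2 S^M T^z3 S^m']; replacing [z2] by [k] and [z1] by [0], which
   is a translation by [t], makes [f] act at the origin. *)
pose m' := (m - (n + M))%N.
have mE : m = (n + (M + m'))%N by rewrite /m'; lia.
pose z1 := (z %% l ^ n)%N; pose z2 := ((z %/ l ^ n) %% l ^ M)%N.
pose z3 := ((z %/ l ^ n) %/ l ^ M)%N.
have zE : z = (z1 + l ^ n * (z2 + l ^ M * z3))%N.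
  by rewrite {1}(divn_eq z (l ^ n)) {1}(divn_eq (z %/ l ^ n) (l ^ M)) -/z1 -/z2 -/z3; ring.
have en := expl_gt0 l_gt1 n; have eM := expl_gt0 l_gt1 M.
have z1l : (z1 < l ^ n)%N by rewrite ltn_mod.
have z2l : (z2 < l ^ M)%N by rewrite ltn_mod.
have z3l : (z3 < l ^ m')%N.
  by rewrite !ltn_divLR // -!expnD (_ : (m' + M + n)%N = m) //; lia.
have [|g Sg gE] := coding_column cL (k := m') (j := z3) _ z3l.
  by rewrite /m'; lia.
pose t : int := h%:Z * ((l ^ n)%N%:Z * (k%:Z - z2%:Z) - z1%:Z).
suff qE v : X0 v -> L v \in (f @: [set: Z])%SET ->
    q (iter n S v) s%:Z = q x0 (s%:Z + t) by rewrite !qE.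
move=> X0v; rewrite -(minimal_rank_image fmin Sg) => /imsetP[a _ Lv].
have [x' X0x' Lx'] := sL a.
pose v' := shift (h%:Z * k%:Z) (iter M S (shift (h%:Z * z3%:Z) (iter m' S x'))).
have X0w : X0 (shift (h%:Z * z3%:Z) (iter m' S x')).
  exact/base_shift/base_subst.
have X0v' : X0 v' by exact/base_shift/base_subst.
have Lv' : L v = L v' by rewrite Lv /v' fE // gE // Lx'.
rewrite (nP X0v X0v' Lv' sl).
have -> : iter n S v' = shift t (shift (h%:Z * z%:Z) (iter m S x')).
  rewrite /v' !(iter_subst_shift, shiftD) // -!iterD -?addnA -mE; apply: eq_shift.
  by rewrite /t zE !(PoszD, PoszM); ring.
have Xw' : X (shift (h%:Z * z%:Z) (iter m S x')).
  exact/base_sub/base_shift/base_subst.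
rewrite factor_shift // {1}/shift -zP //; clear zP.
move: (l ^ n)%N (l ^ M)%N @R @t en eM z1l z2l kl sl => E F R t en eM z1l z2l kl sl.
have E1 : (E * F >= E)%N by nia.
have t1 : - (h * (E * F) + h * E)%N%:Z <= t by rewrite /t; nia.
have t2 : t <= (h * (E * F))%N%:Z by rewrite /t; nia.
rewrite /R; lia.
Qed.

(** The relation of having the same block is transitive, so it propagates along
    chains of overlapping kernel images. *)
Lemma block_class C : C \in coincidence_partition zeta ->
  forall x y (s : nat), X0 x -> X0 y -> L x \in C -> L y \in C ->
  (s < l ^ n * h)%N -> q (iter n S x) s%:Z = q (iter n S y) s%:Z.
Proof.
move=> PC x y s X0x X0y Lx Ly sl.
pose R a b := forall u v, X0 u -> X0 v -> L u = a -> L v = b ->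
  q (iter n S u) s%:Z = q (iter n S v) s%:Z.
suff : R (L x) (L y) by apply.
apply: (coincidence_class_ind (zeta := zeta) (R := R) _ _ PC) => //.
  move=> a b c ab bc u v X0u X0v Lu Lv; have [w X0w Lw] := sL b.
  by rewrite (ab u w) // (bc w v).
move=> D KD a b aD bD u v X0u X0v Lu Lv.
by apply: (block_kernel_image KD) => //; rewrite ?Lu ?Lv.
Qed.

End Block.

(** A periodic sequence of classes is approximated by the codes of points of the
    base; the block code maps these to points of [Y] that are periodic in longer
    and longer windows and accumulate at a periodic point of [Y]. *)
Lemma inner_encoding_aperiodic : X0 !=set0 -> local X0 L -> aperiodic Y ->
  aperiodic (subshift (inner_encoding zeta)).
Proof.
move=> X0n lL aY e Xe [d d0 de].
have [M [cM sM LM]] := inner_coding X0n cL sL lL.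
have [n nP] := block_code.
pose D := (l ^ n * h)%N.
have D0 : (0 < D)%N by rewrite muln_gt0 (expl_gt0 l_gt1).
have eN (N : nat) : exists2 x, X0 x & agree (- N%:Z) N%:Z e (code h M x).
  have [x X0x E] := coding_language cM sM (subshift_word (- N%:Z) (N + N) Xe).
  exists (shift (h%:Z * N%:Z) x); first exact: base_shift.
  rewrite code_shift; move: E; rewrite size_word => /word_agree.
  have -> : - N%:Z + (N + N)%N%:Z = N%:Z by lia.
  by have -> : 0 - - N%:Z = N%:Z by lia.
have /choice[u uP] : forall N : nat, exists x,
    X0 x /\ agree (- N%:Z) N%:Z e (code h M x).
  by move=> N; have [x] := eN N; exists x.
pose v N := q (iter n S (u N)).
have Yv N : Y (v N).
  have [_ <- _] := qF; exists (iter n S (u N)) => //.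
  by apply/base_sub/base_subst; case: (uP N).
have vP (N : nat) i j (s : nat) : (s < D)%N -> - N%:Z <= i < N%:Z ->
    - N%:Z <= j < N%:Z -> e i = e j ->
    v N (D%:Z * i + s%:Z) = v N (D%:Z * j + s%:Z).
  move=> sD iN jN eij; have [X0u euN] := uP N.
  have vE k : v N (D%:Z * k + s%:Z)
      = q (iter n S (shift (h%:Z * k) (u N))) s%:Z.
    rewrite iter_subst_shift // factor_shift; last exact/base_sub/base_subst.
    by rewrite /v [RHS]/shift /D; congr (q _ _); rewrite PoszM; ring.
  rewrite !vE; apply: (block_class nP (valP (M (shift (h%:Z * i) (u N))))) => //.
  - exact: base_shift.
  - exact: base_shift.
  have -> : M (shift (h%:Z * i) (u N)) = M (shift (h%:Z * j) (u N)).
    by have := eij; rewrite !euN.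
  exact: LM.
have [y yP] := cluster_seq v.
apply: (aY y).
  apply: closed_agree Yshift.1 _ => N.
  by have [m _ E] := yP N 0%N; exists (v m).
exists (D * d)%N; first by rewrite muln_gt0 D0.
rewrite iter_left_shift; apply/funext => i; rewrite /shift.
pose a := (i %/ D%:Z)%Z; pose s := absz (i %% D%:Z)%Z.
have sD : (s < D)%N by rewrite /s; have := @ltz_pmod i D%:Z; have := @modz_ge0 i D%:Z; lia.
have iE : i = D%:Z * a + s%:Z.
  by rewrite {1}(divz_eq i D) mulrC /s; have := @modz_ge0 i D%:Z; lia.
pose N := (`|i| + D * d + `|a| + d + 1)%N.
have [m Nm E] := yP N N.
rewrite !E; [|by rewrite /N; lia|by rewrite /N; lia].
have -> : i + (D * d)%N%:Z = D%:Z * (a + d%:Z) + s%:Z.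
  by rewrite {1}iE PoszM; ring.
rewrite [i in RHS]iE; apply: vP => //; [by rewrite /N in Nm; lia|by rewrite /N in Nm; lia|].
by have := congr1 (fun e : fullshift _ => e a) de; rewrite iter_left_shift.
Qed.

End Necessity.

(** * Factors that are constant on a fiber of the odometer *)

Local Notation N_ n := (l ^ n * h)%N.

(** The pairs of points with the same image under [q] differ in the odometer
    by a translation that, by minimality, can be realized over any point. *)
Lemma factor_transport u v w : X u -> X v -> q u = q v -> X w ->
  exists w', [/\ X w', q w' = q w & forall n, exists c : int,
    (p w' n)%:Z = (p w n)%:Z + ((p v n)%:Z - (p u n)%:Z) + c * (N_ n)%:Z].
Proof.
move=> Xu Xv quv Xw.
have /choice[j jP] : forall N : nat, exists j, agree (- N%:Z) N%:Z w (shift j u).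
  by move=> N; exact: subshift_minimal.
have [w' wP] := cluster_seq (fun N => shift (j N) v).
have Xw' : X w'.
  apply: (closed_agree (@subshift_closed _ _ theta l_gt1)) => N.
  have [n _ E] := wP N 0%N; exists (shift (j n) v) => //.
  exact: subshift_shift.
exists w'; split=> // [|n].
  apply/funext => i.
  have [M MP] := factor_local (`|i|.+1)%N Xw.
  have [M' MP'] := factor_local (`|i|.+1)%N Xw'.
  have [N MN E] := wP M' M.
  rewrite (MP' (shift (j N) v)) //; [|exact: subshift_shift|by lia].
  rewrite (MP (shift (j N) u)); [|exact: subshift_shift| |by lia].
    by rewrite !factor_shift // quv.
  by apply: agreeW (jP N); lia.
have [M MP] := odometer_local n Xw; have [M' MP'] := odometer_local n Xw'.
have [N MN E] := wP M' M.
rewrite -(MP' (shift (j N) v)) //; last exact: subshift_shift.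
rewrite -(MP (shift (j N) u)); last first.
- by apply: agreeW (jP N); lia.
- exact: subshift_shift.
have [c cE] := odometer_shift (j N) n Xv.
have [c' cE'] := odometer_shift (j N) n Xu.
exists (c - c'); rewrite cE cE' mulrBl; lia.
Qed.

(** These differences form a subgroup of Z that contains [l^n h]; modulo [l^n h]
    it is the image of the subgroup of the odometer to be divided out. *)
Definition fiber_difference (n : nat) (a : int) : Prop :=
  exists u v, [/\ X u, X v, q u = q v &
    exists c : int, (p v n)%:Z = (p u n)%:Z + a + c * (N_ n)%:Z].

Hypothesis X_nonempty : X !=set0.

Lemma fiber_difference_mul n c : fiber_difference n (c * (N_ n)%:Z).
Proof.
have [x Xx] := X_nonempty; exists x, x; split=> //.
by exists (- c); rewrite mulNr addrK.
Qed.

(** Transport lets the second pair, reversed, start where the first one ends. *)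
Lemma fiber_differenceB n a b :
  fiber_difference n a -> fiber_difference n b -> fiber_difference n (a - b).
Proof.
move=> [u [v [Xu Xv quv [c cE]]]] [u' [v' [Xu' Xv' quv' [c' cE']]]].
have [w [Xw qw /(_ n)[c'' cE'']]] := factor_transport Xv' Xu' (esym quv') Xv.
exists u, w; split=> //; first by rewrite qw.
exists (c'' + c - c'); rewrite cE'' cE' cE mulrBl mulrDl; lia.
Qed.

Lemma fiber_differenceM n a c :
  fiber_difference n a -> fiber_difference n (c * a).
Proof.
move=> Da; have D0 : fiber_difference n 0.
  by have := fiber_difference_mul n 0; rewrite mul0r.
have DN (k : nat) : fiber_difference n (- (k%:Z * a)).
  elim: k => [|k IH]; first by rewrite mul0r oppr0.
  by have := fiber_differenceB IH Da; rewrite -opprD -{2}[a]mul1r -mulrDl -addn1 PoszD.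
case: c => k; last by rewrite NegzE mulNr.
by have := fiber_differenceB D0 (DN k); rewrite sub0r opprK.
Qed.

Lemma fiber_period_exists n :
  exists k : nat, (0 < k)%N && `[< fiber_difference n k%:Z >].
Proof.
exists (N_ n); rewrite muln_gt0 h_gt0 (expl_gt0 l_gt1) /=.
by apply/asboolP; rewrite -[_%:Z]mul1r; exact: fiber_difference_mul.
Qed.

Definition fiber_period n : nat := ex_minn (fiber_period_exists n).

Lemma fiber_period_gt0 n : (0 < fiber_period n)%N.
Proof. by rewrite /fiber_period; case: ex_minnP => k /andP[]. Qed.

Lemma fiber_differenceP n a :
  fiber_difference n a <-> exists c, a = c * (fiber_period n)%:Z.
Proof.
rewrite /fiber_period; case: ex_minnP => k /andP[k0 /asboolP Dk] kmin.
split=> [Da|[c ->]]; last exact: fiber_differenceM.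
exists (a %/ k%:Z)%Z; pose r := (a %% k%:Z)%Z.
have r0 : 0 <= r by apply: modz_ge0; lia.
have rk : r < k%:Z by apply: ltz_pmod; lia.
have aE : a = (a %/ k)%Z * k%:Z + r by exact: divz_eq.
suff r0' : r = 0 by rewrite {1}aE r0' addr0.
apply: contrapT => rn0.
have Dr : fiber_difference n r.
  have := fiber_differenceB Da (fiber_differenceM (a %/ k)%Z Dk).
  by rewrite {1}aE addrC addKr.
have : (k <= absz r)%N.
  apply: kmin; apply/andP; split; first by lia.
  by apply/asboolP; rewrite gez0_abs.
lia.
Qed.

Lemma fiber_period_dvd n : (fiber_period n %| fiber_period n.+1)%N.
Proof.
suff /fiber_differenceP[c E] : fiber_difference n (fiber_period n.+1)%:Z.
  apply/dvdnP; exists (absz c); have := fiber_period_gt0 n; nia.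
have [|u [v [Xu Xv quv [c cE]]]] := (fiber_differenceP n.+1 (fiber_period n.+1)%:Z).2.
  by exists 1; rewrite mul1r.
exists u, v; split=> //.
have pE x : X x -> exists c : int, (p x n)%:Z = (p x n.+1)%:Z + c * (N_ n)%:Z.
  move=> Xx; exists (- (p x n.+1 %/ N_ n)%N%:Z).
  have := odometer_mod n 1 Xx; rewrite addn1 => ->.
  by have := divn_eq (p x n.+1) (N_ n); lia.
have [c1 E1] := pE _ Xu; have [c2 E2] := pE _ Xv.
exists (c2 + c * l%:Z - c1); rewrite E2 cE E1 expnS -mulnA PoszM; ring.
Qed.

Definition fiber_scale : scale := Scale fiber_period_gt0 fiber_period_dvd.

Lemma fiber_period_mod n : (fiber_period n %| N_ n)%N.
Proof.
have /fiber_differenceP[c E] := fiber_difference_mul n 1.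
apply/dvdnP; exists (absz c); have := fiber_period_gt0 n; nia.
Qed.

Lemma eq_mod_int (a b m : nat) :
  (exists c : int, a%:Z = b%:Z + c * m%:Z) -> a = b %[mod m].
Proof.
move=> [c E]; have : (a%:Z = b%:Z %[mod m%:Z])%Z by rewrite E addrC modzMDl.
by rewrite !modz_nat => -[].
Qed.

Lemma mod_int_eq (a b m : nat) :
  a = b %[mod m] -> exists c : int, a%:Z = b%:Z + c * m%:Z.
Proof.
move=> E; exists ((a %/ m)%N%:Z - (b %/ m)%N%:Z).
by rewrite {1}(divn_eq a m) {1}(divn_eq b m) E !PoszD !PoszM; ring.
Qed.

Lemma fiber_residue_subproof x : X x ->
  forall n, p x n.+1 = p x n %[mod fiber_scale n].
Proof.
move=> Xx n; have := odometer_mod n 1 Xx; rewrite addn1 => ->.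
by rewrite modn_dvdm // fiber_period_mod.
Qed.

(** The image of [p x] in the quotient of the odometer; the value outside [X] is
    a default. *)
Definition fiber_residue x : procyclic fiber_scale :=
  match pselect (X x) with
  | left Xx => procyclic_of (fiber_residue_subproof Xx)
  | right _ => 0
  end.

Lemma fiber_residueE x n :
  X x -> fiber_residue x n = (p x n %% fiber_period n)%N.
Proof. by rewrite /fiber_residue; case: pselect. Qed.

Lemma fiber_residue_factor x y : X x -> X y -> q x = q y ->
  fiber_residue x = fiber_residue y.
Proof.
move=> Xx Xy qxy; apply: procyclic_eq => n; rewrite !fiber_residueE //.
have /fiber_differenceP[c E] : fiber_difference n ((p x n)%:Z - (p y n)%:Z).
  exists y, x; split=> //; exists 0; lia.
by apply: eq_mod_int; exists c; lia.
Qed.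

Lemma fiber_residue_shift x : X x ->
  fiber_residue (shift 1 x) = fiber_residue x + @procyclic_one fiber_scale.
Proof.
move=> Xx; apply: procyclic_eq => n; rewrite fiber_residueE; last exact: subshift_shift.
rewrite /= fiber_residueE // modnDm; apply: eq_mod_int.
have [c ->] := odometer_shift 1 n Xx; have /dvdnP[e ->] := fiber_period_mod n.
by exists (c * e%:Z); rewrite PoszM; lia.
Qed.

(** The orbit of any point has dense image, and the image is compact. *)
Lemma fiber_residue_surj (z : procyclic fiber_scale) :
  exists2 x, X x & fiber_residue x = z.
Proof.
have [x Xx] := X_nonempty.
have [y yP] := cluster_seq (fun n => shift ((z n)%:Z - (p x n)%:Z) x).
have Xy : X y.
  apply: (closed_agree (@subshift_closed _ _ theta l_gt1)) => N.
  have [n _ E] := yP N 0%N; exists (shift ((z n)%:Z - (p x n)%:Z) x) => //.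
  exact: subshift_shift.
exists y => //; apply: procyclic_eq => n.
have [M MP] := odometer_local n Xy; have [N nN E] := yP M n.
have Xs : X (shift ((z N)%:Z - (p x N)%:Z) x) by exact: subshift_shift.
transitivity (fiber_residue (shift ((z N)%:Z - (p x N)%:Z) x) n).
  by rewrite !fiber_residueE // MP.
apply: (residue_le nN); rewrite fiber_residueE // -[RHS]residue_mod.
apply: eq_mod_int; have [c ->] := odometer_shift ((z N)%:Z - (p x N)%:Z) N Xx.
have /dvdnP[e ->] := fiber_period_mod N.
by exists (c * e%:Z); rewrite PoszM; lia.
Qed.

(** If the residues of [x] and [x0] agree then, by transport, some point with the
    same image as [x] has the same odometer coordinates as [x0]. *)
Lemma fiber_residue_inj x0 x : X x0 -> X x ->
  (forall x, X x -> (forall n, p x n = p x0 n) -> q x = q x0) ->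
  fiber_residue x = fiber_residue x0 -> q x = q x0.
Proof.
move=> Xx0 Xx x0_fiber E.
have : forall n : nat, exists w, [/\ X w, q w = q x & p w n = p x0 n].
  move=> n; have := congr1 (fun z : procyclic _ => z n) E.
  rewrite /= !fiber_residueE // => /mod_int_eq[c cE].
  have [u [v [Xu Xv quv [c' cE']]]] :
      fiber_difference n ((p x0 n)%:Z - (p x n)%:Z).
    by apply/fiber_differenceP; exists (- c); lia.
  have [w [Xw qw /(_ n)[c'' cE'']]] := factor_transport Xu Xv quv Xx.
  exists w; split=> //.
  have lt1 := odometer_lt n Xw; have lt2 := odometer_lt n Xx0.
  rewrite -(modn_small lt1) -(modn_small lt2); apply: eq_mod_int.
  by exists (c' + c''); rewrite cE'' cE' mulrDl; lia.
move=> /choice[u uP]; have [w wP] := cluster_seq u.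
have Xw : X w.
  apply: (closed_agree (@subshift_closed _ _ theta l_gt1)) => N.
  by have [n _ Ew] := wP N 0%N; exists (u n) => //; case: (uP n).
rewrite -(x0_fiber w) // => [|n].
  apply/funext => i; have [M MP] := factor_local (`|i|.+1)%N Xw.
  have [n _ Ew] := wP M 0%N; have [Xu <- _] := uP n.
  by rewrite (MP (u n)) //; lia.
have [M MP] := odometer_local n Xw; have [m nm Ew] := wP M n.
have [Xu _ pu] := uP m.
by rewrite -(MP (u m)) // -(subnKC nm) !(odometer_mod n (m - n)) // subnKC // pu.
Qed.

Lemma almost_automorphic_constant_fiber x0 : X x0 ->
  (forall x, X x -> (forall n, p x n = p x0 n) -> q x = q x0) ->
  almost_automorphic Y (@left_shift B).
Proof.
move=> Xx0 x0_fiber; have [_ qX qs] := qF; have [cY _] := Yshift.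
have : forall y : fullshift B, exists x, Y y -> X x /\ q x = y.
  move=> y; have [Yy|] := pselect (Y y); last by exists x0.
  by move: Yy; rewrite -qX => -[x Xx <-]; exists x.
move=> /choice[s sP]; pose r (b : fullshift B) := fiber_residue (s b).
have rE x : X x -> r (q x) = fiber_residue x.
  move=> Xx; have [|Xs qsx] := sP (q x); first by rewrite -qX; exists x.
  exact: fiber_residue_factor.
have rc : {within Y, continuous r}.
  apply: within_agreeP => y U Yy [n nU].
  have [N NP] : exists N : nat, forall z, Y z ->
      agree (- N%:Z) N%:Z y z -> r z n = r y n; last first.
    by exists N => z Yz /(NP _ Yz); exact: nU.
  apply: contrapT => H.
  have : forall N : nat, exists x,
      [/\ X x, agree (- N%:Z) N%:Z y (q x) & r (q x) n <> r y n].
    move=> N; apply: contrapT => H'; apply: H; exists N => z Yz yz.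
    apply: contrapT => H''; apply: H'; have [Xs qs'] := sP _ Yz.
    by exists (s z); rewrite qs'.
  move=> /choice[u uP]; have [x xP] := cluster_seq u.
  have Xx : X x.
    apply: (closed_agree (@subshift_closed _ _ theta l_gt1)) => N.
    by have [m _ E] := xP N 0%N; exists (u m) => //; case: (uP m).
  have qx : q x = y.
    apply/funext => i; have [M MP] := factor_local (`|i|.+1)%N Xx.
    have [m im E] := xP M (`|i|.+1)%N; have [Xu yu _] := uP m.
    by rewrite (MP (u m)) // ?yu //; lia.
  have [M MP] := odometer_local n Xx; have [m _ E] := xP M 0%N.
  have [Xu _] := uP m; apply.
  by rewrite -qx !rE // !fiber_residueE // MP.
have rY : r @` Y = setT.
  apply/seteqP; split=> // z _; have [x Xx xz] := fiber_residue_surj z.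
  by exists (q x); [rewrite -qX; exists x|rewrite rE].
exists (procyclic fiber_scale), (procyclic_one _), r; split.
- rewrite -rY; apply: continuous_compact => //.
  exact: subclosed_compact cY (@compact_fullshift B) _.
- exact: procyclic_hausdorff.
- split=> // y; rewrite -qX => -[x Xx <-].
  by rewrite -qs // !rE // ?fiber_residue_shift //; exact: (subshift_shift 1).
exists (r (q x0)) => //; exists (q x0); split.
  by split=> //; rewrite -qX; exists x0.
move=> y []; rewrite -{1}qX => -[x Xx <-]; rewrite !rE // => E.
exact/esym/(fiber_residue_inj Xx0 Xx).
Qed.

End Factor.

(** * An aperiodic inner encoding gives an almost automorphic factor *)

Section Sufficiency.
Variables (Z : finType) (zeta : substitution l Z) (L : fullshift A -> Z).
Hypothesis X0_nonempty : X0 !=set0.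
Hypothesis cL : coding zeta L.
Hypothesis lL : local X0 L.
Variable M : fullshift A -> inner_alphabet zeta.
Hypothesis cM : coding (inner_encoding zeta) M.
Hypothesis LM : forall x, L x \in val (M x).

Lemma inner_code_class x y C : C \in kernel_images zeta ->
  L x \in C -> L y \in C -> M x = M y.
Proof.
move=> /kernel_image_class[D PD /fintype.subsetP CD] /CD Lx /CD Ly.
apply: val_inj; transitivity D.
  exact: coincidence_class_uniq (valP _) PD (LM x) Lx.
exact: coincidence_class_uniq PD (valP _) Ly (LM y).
Qed.

Lemma inner_code_local : local X0 M.
Proof.
have [r rP] := lL; exists r => x y X0x X0y xy.
apply: val_inj; apply: coincidence_class_uniq (valP _) (valP _) (LM x) _.
by rewrite (rP x y).
Qed.

(** An element of the kernel has its values in one class, so the corresponding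
    column of the inner encoding is constant; so are all the columns that a
    further power of the substitution produces from it. Three consecutive ones
    are needed to control the windows on both sides of a point. *)
Lemma inner_coincidence : exists n t : nat, [/\ (0 < n)%N, (0 < t)%N, (t.+1 < l ^ n)%N
  & forall j x y, - 1 <= j <= 1 -> X0 x -> X0 y ->
    M (shift (h%:Z * (t%:Z + j)) (iter n S x))
    = M (shift (h%:Z * (t%:Z + j)) (iter n S y))].
Proof.
have [f kf Kf] := kernel_images_nonempty zeta (ltnW l_gt1).
have [Sf _] := (kernelP zeta (ltnW l_gt1) f).1 kf.
have [k [i [k0 il fE]]] := column_coding cL Sf.
have l2 : (4 <= l ^ 2)%N by rewrite -[4%N]/(2 ^ 2)%N leq_exp2r.
(* Two more levels turn one constant column into [l^2 >= 4] consecutive ones;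
   [t] is the second of these. *)
exists (2 + k)%N, (l ^ 2 * i + 1)%N; split=> //.
- by rewrite addn1.
- by rewrite expnD; nia.
move=> j x y j1 X0x X0y.
pose m := absz (j + 1).
have ml : (m < l ^ 2)%N by rewrite /m; lia.
have [g _ gE] := coding_column cM (k := 2) isT ml.
have E z : shift (h%:Z * ((l ^ 2 * i + 1)%N%:Z + j)) (iter (2 + k) S z)
    = shift (h%:Z * m%:Z) (iter 2 S (shift (h%:Z * i%:Z) (iter k S z))).
  rewrite iter_subst_shift // shiftD -iterD; apply: eq_shift.
  have -> : m%:Z = j + 1 by rewrite /m; lia.
  by rewrite PoszD PoszM; ring.
rewrite !E !gE; [|exact/base_shift/base_subst|exact/base_shift/base_subst].
by congr g; apply: (inner_code_class Kf); rewrite fE // imset_f.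
Qed.

(** Iterating the coincident column gives a point [x0] whose code is determined
    in arbitrarily large windows by its digits in the odometer. *)
Lemma inner_code_fiber : exists2 x0, X0 x0 &
  forall x, X x -> (forall n, p x n = p x0 n) ->
  X0 x /\ code h M x = code h M x0.
Proof.
have [n [t [n0 t0 tl tP]]] := inner_coincidence.
pose V x := shift (h%:Z * t%:Z) (iter n S x).
have VE (i : nat) : exists2 ti : nat, (ti < l ^ (n * i))%N &
    forall x, X0 x -> iter i V x = shift (h%:Z * ti%:Z) (iter (n * i) S x).
  elim: i => [|i [ti til tiE]].
    by exists 0%N => // x _; rewrite mulr0 shift0 muln0.
  exists (ti + l ^ (n * i) * t)%N.
    by rewrite mulnS addnC [(n + _)%N]addnC expnD; nia.
  move=> x X0x; rewrite iterSr tiE; last exact/base_shift/base_subst.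
  rewrite iter_subst_shift // shiftD -iterD mulnS [(n + _)%N]addnC.
  by apply: eq_shift; rewrite PoszD PoszM; ring.
have V0 (i : nat) x : X0 x -> X0 (iter i V x).
  by move=> X0x; elim: i => // i IH; exact/base_shift/base_subst.
have [a X0a] := X0_nonempty.
have [x0 x0P] := cluster_seq (fun m => iter m V a).
have X0x0 : X0 x0.
  apply: closed_agree base_closed _ => N; have [m _ E] := x0P N 0%N.
  by exists (iter m V a) => //; exact: V0.
exists x0 => // x Xx px.
have VP (i : nat) z : X z -> (forall n, p z n = p x0 n) -> exists2 w, X0 w & z = iter i V w.
  move=> Xz pz; have X0z : X0 z by exact: odometer_base Xz X0x0 (pz 0%N).
  have [ti til tiE] := VE i.
  have [N NP] := odometer_local (n * i) (base_sub X0x0).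
  have [m im E] := x0P N i.
  have [|w X0w zE] := odometer_desubst X0z (V0 (m - i)%N _ X0a) til.
    rewrite -tiE; last exact: V0.
    rewrite -iterD subnKC // pz NP //; exact/base_sub/V0.
  by exists w; rewrite // tiE.
have X0x : X0 x by exact: odometer_base Xx X0x0 (px 0%N).
split=> //; apply/funext => s; rewrite /code.
pose i : nat := absz s.
have [w X0w ->] := VP i.+1 x Xx px.
have [w' X0w' ->] := VP i.+1 x0 (base_sub X0x0) (fun _ => erefl).
rewrite !iterSr; have [ti til tiE] := VE i.
rewrite !tiE; [|exact/base_shift/base_subst|exact/base_shift/base_subst].
have e0 := expl_gt0 l_gt1 (n * i).
have ie : (i < l ^ (n * i))%N.
  exact: leq_ltn_trans (leq_pmull i n0) (expl_gt l_gt1 (n * i)).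
(* Place [s] of [V^(i+1)] falls into the image under [S^(n i)] of the column
   [t + e], with [e] in {-1, 0, 1} as [s] is smaller than [l^(n i)]. *)
pose e := ((s + ti%:Z) %/ (l ^ (n * i))%N%:Z)%Z.
pose m := absz ((s + ti%:Z) %% (l ^ (n * i))%N%:Z)%Z.
have mE : m%:Z = ((s + ti%:Z) %% (l ^ (n * i))%N%:Z)%Z.
  by rewrite /m gez0_abs // modz_ge0 //; lia.
have ml : (m < l ^ (n * i))%N.
  by rewrite -ltz_nat mE ltz_pmod //; lia.
have E z : shift (h%:Z * s) (shift (h%:Z * ti%:Z) (iter (n * i) S (V z)))
    = shift (h%:Z * m%:Z) (iter (n * i) S (shift (h%:Z * (t%:Z + e)) (iter n S z))).
  rewrite /V !iter_subst_shift // !shiftD; apply: eq_shift.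
  have := divz_eq (s + ti%:Z) (l ^ (n * i))%N%:Z; rewrite -/e -mE => sE.
  have -> : s = e * (l ^ (n * i))%N%:Z + m%:Z - ti%:Z by rewrite -sE addrK.
  ring.
have e1 : - 1 <= e <= 1.
  rewrite /e; have s1 : - (l ^ (n * i))%N%:Z < s < (l ^ (n * i))%N%:Z.
    by move: (l ^ (n * i))%N ie; rewrite /i => K; lia.
  move: (l ^ (n * i))%N til e0 s1 => K til e0 s1.
  by rewrite lez_divRL -?ltzD1 ?ltz_divLR; lia.
rewrite !E.
have [i0|i0] := posnP i.
  have -> : m = 0%N by rewrite i0 muln0 expn0 in ml; lia.
  rewrite i0 muln0 mulr0 !shift0; exact: tP.
have [|g _ gE] := coding_column cM (k := n * i) (j := m) _ ml.
  by rewrite muln_gt0 n0.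
rewrite !gE; [|exact/base_shift/base_subst|exact/base_shift/base_subst].
by congr g; exact: tP.
Qed.

Lemma phase_exists : exists phase : fullshift A -> 'I_h,
  forall x, X x -> X0 (shift (- (phase x : nat)%:Z) x).
Proof.
have : forall x, exists k : 'I_h, X x -> X0 (shift (- (k : nat)%:Z) x).
  move=> x; have [Xx|nXx] := pselect (X x); last by exists (Ordinal h_gt0).
  by have [k kh X0k] := base_phase Xx; exists (Ordinal kh).
by move=> /choice[phase phaseP]; exists phase => x; exact: phaseP.
Qed.

Lemma phase_uniq x (i k : nat) : (i < h)%N -> (k < h)%N ->
  X0 (shift (- i%:Z) x) -> X0 (shift (- k%:Z) x) -> i = k.
Proof.
move=> ih kh X0i X0k.
have [|c E] := base_align (j := i%:Z - k%:Z) X0i.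
  by rewrite shiftD addrAC subrr add0r.
have [c0|c0|c0] := ltgtP c 0; [nia|nia|].
by move: E; rewrite c0; lia.
Qed.

(** The factor reads at each place the class of the letter over which that place
    lies and its height above the beginning of this letter. *)
Lemma almost_automorphic_factor :
  aperiodic (subshift (inner_encoding zeta)) ->
  exists (B : finType) (Y : set (fullshift B)),
  [/\ is_shift Y,
      exists q : fullshift A -> fullshift B,
        factor_map X (@left_shift A) Y (@left_shift B) q,
      aperiodic Y & almost_automorphic Y (@left_shift B)].
Proof.
move=> aE; have [phase phaseP] := phase_exists.
pose letter x := (M (shift (- (phase x)%:Z) x), phase x).
pose B : finType := (inner_alphabet zeta * 'I_h)%type.
pose q x : fullshift B := fun i => letter (shift i x).
have q_shift i x : q (shift i x) = shift i (q x).
  by apply/funext => j; rewrite [RHS]/shift /q shiftD.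
have letterE x (k : nat) (kh : (k < h)%N) : X0 x ->
    letter (shift k%:Z x) = (M x, Ordinal kh).
  move=> X0x; have Xx : X (shift k%:Z x) by exact/subshift_shift/base_sub.
  have X0k : X0 (shift (- k%:Z) (shift k%:Z x)) by rewrite shiftK.
  have pk := phase_uniq (ltn_ord _) kh (phaseP _ Xx) X0k.
  by rewrite /letter {1}pk shiftK; congr (_, _); apply: val_inj.
have qE x (i : int) : X0 x -> q x i =
    (code h M x (i %/ h%:Z)%Z, (q x i).2) /\ ((q x i).2 : nat)%:Z = (i %% h%:Z)%Z.
  move=> X0x; have m0 : 0 <= (i %% h%:Z)%Z by apply: modz_ge0; lia.
  have mh : (absz (i %% h%:Z)%Z < h)%N.
    by rewrite -ltz_nat gez0_abs // ltz_pmod //; lia.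
  have -> : q x i = (code h M x (i %/ h%:Z)%Z, Ordinal mh).
    rewrite /q -(letterE _ _ mh); last exact: base_shift.
    rewrite shiftD gez0_abs //; congr letter; apply: eq_shift.
    by rewrite {1}(divz_eq i h); ring.
  by split=> //=; rewrite gez0_abs.
pose Y := q @` X.
have qF : factor_map X (@left_shift A) Y (@left_shift B) q.
  split=> //; last by move=> x _; exact: (q_shift 1).
  apply: within_agreeP => x U Xx /nbhs_fullshift[N NU].
  have [r rP] := inner_code_local.
  exists (N + 2 * h + r)%N => y Xy xy; apply: NU => i iN.
  have Xix : X (shift i x) by exact: subshift_shift.
  have Xiy : X (shift i y) by exact: subshift_shift.
  have kh := ltn_ord (phase (shift i x)); have X0x := phaseP _ Xix.
  move: X0x kh; set k := phase (shift i x) => X0x kh.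
  have X0y : X0 (shift (- k%:Z) (shift i y)).
    apply: base_cylinder X0x _ _; first exact: subshift_shift.
    by rewrite !shiftD; apply: agree_shift; apply: agreeW xy; lia.
  have pk := phase_uniq (ltn_ord _) kh (phaseP _ Xiy) X0y.
  rewrite /q /letter -/k pk; congr (_, _); last exact/val_inj/esym.
  apply: rP => //; rewrite !shiftD; apply: agree_shift.
  by apply: agreeW xy; lia.
have [_ qX _] := qF.
have Yshift : is_shift Y.
  split.
    rewrite /Y; apply: compact_closed; first exact: hausdorff_fullshift.
    apply: continuous_compact; first by case: qF.
    exact: subclosed_compact (subshift_closed l_gt1) (@compact_fullshift A) _.
  apply/seteqP; split=> [_ [_ [x Xx <-] <-]|_ [x Xx <-]].
    by exists (shift 1 x); [exact: subshift_shift|exact: (q_shift 1)].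
  exists (q (shift (-1) x)); first by exists (shift (-1) x) => //; exact: subshift_shift.
  by rewrite left_shiftE -q_shift shiftD subrr shift0.
exists B, Y; split=> //; first by exists q.
  move=> _ [x Xx <-] [d d0]; rewrite iter_left_shift => qd.
  have X0x := phaseP _ Xx; set z := shift _ x in X0x.
  have qz : shift d%:Z (q z) = q z.
    by rewrite q_shift shiftD addrC -shiftD qd.
  have qzn (c : nat) : shift (d%:Z * c%:Z) (q z) = q z.
    elim: c => [|c IH]; first by rewrite mulr0 shift0.
    by rewrite -{2}IH -{2}qz shiftD; apply: eq_shift; lia.
  apply: (aE (code h M z)); first exact: (coding_subshift cM inner_code_local).
  exists d => //; rewrite iter_left_shift; apply/funext => c.
  have := congr1 (fun y : fullshift B => (y (h%:Z * c)).1) (qzn h).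
  rewrite /shift (qE _ _ X0x).1 [in RHS](qE _ _ X0x).1 /=.
  have -> : h%:Z * c + d%:Z * h%:Z = (c + d%:Z) * h%:Z by ring.
  by rewrite mulzK ?[h%:Z * c]mulrC ?mulzK //; lia.
have [x0 X0x0 x0P] := inner_code_fiber.
apply: (almost_automorphic_constant_fiber Yshift qF _ (base_sub X0x0)).
  by exists x0; exact: base_sub.
move=> x Xx px; have [X0x cx] := x0P x Xx px.
apply/funext => i; have [-> E] := qE x i X0x; have [-> E'] := qE x0 i X0x0.
by rewrite cx; congr (_, _); apply: val_inj; apply/eqP; rewrite -eqz_nat E E'.
Qed.

End Sufficiency.
End Tower.

(** * The characterization *)

Theorem theorem1p1 (l : nat) (A : finType) (theta : substitution l A)
    (h : nat) (P : nat -> set (fullshift A))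
    (l_ge2 : (2 <= l)%N)
    (theta_primitive : primitive theta)
    (theta_aperiodic : aperiodic (subshift theta))
    (theta_periodic_fixed : periodic_points_fixed theta)
    (h_height : is_height theta h)
    (P_partition : height_partition theta h P) :
  (exists (B : finType) (Y : set (fullshift B)),
     [/\ is_shift Y,
         exists p : fullshift A -> fullshift B,
           factor_map (subshift theta) (@left_shift A) Y (@left_shift B) p,
         aperiodic Y
       & almost_automorphic Y (@left_shift B)])
  <->
  aperiodic (subshift (inner_encoding (collar (pure_base P_partition) 1 1))).
Proof.
have [h_gt0 _ [p pmax]] := h_height; have [_ pF _] := pmax.
have X0n : P 0%N !=set0.
  have [_ pX _] := pF.
  have : odometer l h (fun=> 0%N).
    by move=> n; rewrite mod0n muln_gt0 h_gt0 (expl_gt0 l_ge2).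
  rewrite -pX => -[x Xx _].
  by have [k _ X0x] := base_phase l_ge2 h_gt0 P_partition Xx; exists (shift (- k%:Z) x).
have [L [cL sL LE]] := collared_base_coding l_ge2 h_gt0 theta_primitive P_partition X0n.
have lL : local (P 0%N) L.
  exists (2 * h)%N => x y X0x X0y xy; apply/LE => //; apply: agreeW xy; lia.
split=> [[B [Y [Yshift [q qF] aY aaY]]]|aE].
  have [x0 X0x0 x0P] := constant_fiber l_ge2 h_gt0 P_partition pF qF pmax aaY.
  exact: (inner_encoding_aperiodic l_ge2 h_gt0 theta_primitive P_partition pF
    Yshift qF X0x0 x0P cL sL LE X0n lL aY).
have [M [cM _ LM]] :=
  inner_coding l_ge2 h_gt0 theta_primitive P_partition X0n cL sL lL.
exact: (almost_automorphic_factor l_ge2 h_gt0 theta_primitive P_partition pF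
  X0n cL lL cM LM aE).
Qed.
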